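(* Let $A\in\mathbb R^{n\times n}$, $B\in\mathbb R^{n\times m}$, $D\in\mathbb R^{n\times r}$, let $u_0,u_1,\dots\in\mathbb R^m$ be a deterministic input sequence, and let $\varepsilon,\varepsilon_1,\varepsilon_2\ge 0$. For $t\ge1$ let $\mathbf u_{[t-1]}=[u_{t-1}^\top\ u_{t-2}^\top\cdots u_0^\top]^\top$, $\mathbf B_{t-1}=[B\ AB\cdots A^{t-1}B]$, $\mathbf D_{t-1}=[D\ AD\cdots A^{t-1}D]$. 1) Consider $x_{t+1}=Ax_t+Bu_t$ with $x_0\sim\mathbb Q_0\in\mathbb B_\varepsilon^{\|\cdot\|_2^2}(\mathbb P_0)$, where $\mathbb P_0\in\mathcal P(\mathbb R^n)$. Then, for every $t\ge1$, the distribution $\mathbb Q_t$ of $x_t$ satisfies $$\mathbb Q_t\in\mathbb B_\varepsilon^{\|\cdot\|_2^2\circ(A^t)^\dagger}\big(\delta_{\mathbf B_{t-1}\mathbf u_{[t-1]}}\ast(A^t_{\#}\mathbb P_0)\big).$$ 2) Consider $x_{t+1}=Ax_t+Bu_t+Dw_t$ with deterministic $x_0\in\mathbb R^n$ and, for $t\ge1$, let the noise trajectory $\mathbf w_{[t-1]}=[w_{t-1}^\top\cdots w_0^\top]^\top$ have a distribution belonging to $\mathbb B_\varepsilon^{\|\cdot\|_2^2}(\mathbb P_t)$, where $\mathbb P_t\in\mathcal P(\mathbb R^{rt})$. Then the distribution $\mathbb Q_t$ of $x_t$ satisfies $$\mathbb Q_t\in\mathbb B_\varepsilon^{\|\cdot\|_2^2\circ\mathbf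 D_{t-1}^\dagger}\big(\delta_{A^tx_0+\mathbf B_{t-1}\mathbf u_{[t-1]}}\ast((\mathbf D_{t-1})_{\#}\mathbb P_t)\big).$$ 3) Consider $x_{t+1}=w^{(1)}_t\cdot Ax_t+w^{(2)}_t\cdot Bu_t$ with deterministic $x_0\in\mathbb R^n$, where for every $t$ the random vectors $x_t,w_t^{(1)},w_t^{(2)}$ are independent, $w^{(1)}_t\sim\mathbb Q^{(1)}\in\mathbb B_{\varepsilon_1}^{\|\cdot\|_2^2}(\mathbb P^{(1)})$ and $w^{(2)}_t\sim\mathbb Q^{(2)}\in\mathbb B_{\varepsilon_2}^{\|\cdot\|_2^2}(\mathbb P^{(2)})$, with $\mathbb P^{(1)},\mathbb P^{(2)}\in\mathcal P(\mathbb R^n)$. Then, for every $t\ge 0$, the distribution $\mathbb Q_t$ of $x_t$ satisfies $\mathbb Q_t\in\mathbb B_{\rho_t}^{\|\cdot\|_2^2}(\mathbb P_t)$, where $\mathbb P_t\in\mathcal P(\mathbb R^n)$ and $\rho_t\ge0$ are defined recursively by $\mathbb P_0=\delta_{x_0}$, $\rho_0=0$, and for $t\ge1$ $$\mathbb P_t=\big(\mathbb P^{(1)}\odot A_{\#}\mathbb P_{t-1}\big)\ast\big(\mathbb P^{(2)}\odot\delta_{Bu_{t-1}}\big),$$ $$\rho_t=\Big(\sqrt{\varepsilon_1\rho_{t-1}}\,\sigma_{\max}(A)+\sqrt{\rho_{t-1}M_{\mathbb P^{(1)}}}\,\sigma_{\max}(A)+\sqrt{\varepsilon_1M_{A_{\#}\mathbb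 P_{t-1}}}+\sqrt{\varepsilon_2}\,\|Bu_{t-1}\|_2\Big)^2,$$ where $\sigma_{\max}(A)$ is the maximum singular value of $A$ and $M_{\mathbb P}=\int_{\mathbb R^n}\|x\|_2^2\,d\mathbb P(x)$.
   Context: $\mathcal P(\mathbb R^k)$ is the set of Borel probability distributions on $\mathbb R^k$; $\delta_x$ is the delta distribution at $x$. For a matrix $L$, $L_{\#}\mathbb P$ is the pushforward of $\mathbb P$ under $x\mapsto Lx$ and $L^\dagger$ is the (standard Euclidean) Moore-Penrose inverse; $A^t_{\#}$ is pushforward under the matrix power $A^t$. $\cdot$ between vectors denotes the element-wise product. $\mathbb P\ast\mathbb Q$ and $\mathbb P\odot\mathbb Q$ are the distributions of $x+y$ and $x\cdot y$ for independent $x\sim\mathbb P$, $y\sim\mathbb Q$. For a cost $c:\mathbb R^k\to\mathbb R_{\ge0}$, $W_c(\mathbb P,\mathbb Q)=\inf_{\gamma\in\Gamma(\mathbb P,\mathbb Q)}\int c(x_1-x_2)\,d\gamma(x_1,x_2)$ with $\Gamma(\mathbb P,\mathbb Q)$ the set of couplings, and $\mathbb B_\varepsilon^c(\mathbb P)=\{\mathbb Q\in\mathcal P(\mathbb R^k):W_c(\mathbb P,\mathbb Q)\le\varepsilon\}$. The cost $\|\cdot\|_2^2$ is $c(x)=\|x\|_2^2$, and $\|\cdot\|_2^2\circ L^\dagger$ is $x\mapsto\|L^\dagger x\|_2^2$. Second moments may be $+\infty$, with $0\cdot\infty=0$. *)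

(* Defs.v *)
From HB Require Import structures.
From mathcomp Require Import all_boot all_order all_algebra.
From mathcomp Require Import all_classical all_reals all_analysis.
From mathcomp Require Import measurable_realfun.

Set Implicit Arguments.
Unset Strict Implicit.
Unset Printing Implicit Defensive.

Import Order.TTheory GRing.Theory Num.Theory.
Import numFieldNormedType.Exports.

Local Open Scope classical_set_scope.
Local Open Scope ring_scope.

Section borel_matrix.
Variables (R : realType) (m n : nat).

Definition borel_mx : set (set 'M[R]_(m, n)) := <<s @open 'M[R]_(m, n) >>.

Let borel_mx0 : borel_mx set0.
Proof. exact: sigma_algebra0. Qed.

Let borel_mxC A : borel_mx A -> borel_mx (~` A).
Proof. exact: sigma_algebraC. Qed.

Let borel_mx_bigcup (F : (set 'M[R]_(m, n))^nat) :
  (forall i, borel_mx (F i)) -> borel_mx (\bigcup_i F i).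
Proof. exact: sigma_algebra_bigcup. Qed.

HB.instance Definition _ := @isMeasurable.Build
  (sigma_display (@open 'M[R]_(m, n))) 'M[R]_(m, n)
  borel_mx borel_mx0 borel_mxC borel_mx_bigcup.

End borel_matrix.

Section measurable_matrix.
Variable R : realType.

Lemma open_measurable_mx m n (U : set 'M[R]_(m, n)) : open U -> measurable U.
Proof. by move=> oU; apply: sub_sigma_algebra. Qed.

Lemma measurable_coord m n i j :
  measurable_fun setT (fun M : 'M[R]_(m, n) => M i j).
Proof.
apply: (measurability _ (RGenOpens.measurableE R)) => _ [_ [a [b ->] <-]].
rewrite setTI; apply: open_measurable_mx.
by apply: open_comp => [M _|]; [exact: coord_continuous|exact: interval_open].
Qed.

Lemma measurable_fun_mxP d (T : measurableType d) m n (f : T -> 'M[R]_(m, n)) :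
  measurable_fun setT f <-> forall i j, measurable_fun setT (fun t => f t i j).
Proof.
split=> [mf i j|mf].
  exact: (measurableT_comp (measurable_coord i j) mf).
apply: (@measurability _ _ _ _ _ _ (@open 'M[R]_(m, n))) => // _ [U oU <-].
rewrite setTI.
pose box (q : 'M[rat]_(m, n) * rat) : set 'M[R]_(m, n) :=
  [set M | forall i j, ball (ratr (q.1 i j) : R) (ratr q.2) (M i j)].
pose F k : set T := if unpickle k is Some q then
  (if `[< box q `<=` U >] then f @^-1` box q else set0) else set0.
rewrite (_ : f @^-1` U = \bigcup_k F k); last first.
  rewrite eqEsubset; split=> [t Uft|t [k _]]; last first.
    rewrite /F; case: unpickle => // q; case: asboolP => // bU bt; exact: bU.
  have /nbhs_ballP[e /= e0 eU] : nbhs (f t) U by exact/open_nbhs_nbhs.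
  have /rat_in_itvoo[q /itvP qe] : (0 : R) < e / 2 by rewrite divr_gt0.
  have q0 : (0 : R) < ratr q by rewrite qe.
  have /choice[g gP] (ij : 'I_m * 'I_n) :
      exists r, ball (f t ij.1 ij.2) (ratr q) (ratr r : R).
    have : ball (f t ij.1 ij.2) (ratr q) `&` range ratr !=set0.
      apply: dense_rat; last exact: ball_open.
      by exists (f t ij.1 ij.2); apply: ballxx.
    by move=> [/= _ []] /[swap] -[y _ <-]; exists y.
  pose Q := (\matrix_(i, j) g (i, j), q).
  exists (pickle Q) => //; rewrite /F pickleK asboolT; last first.
    move=> M bM; apply: eU; split => // i j.
    rewrite (splitr e); apply: (ball_triangle (y := ratr (g (i, j)) : R)).
      by have := gP (i, j); apply: le_ball; rewrite ltW//= qe.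
    by have := bM i j; rewrite mxE; apply: le_ball; rewrite ltW//= qe.
  by move=> i j; rewrite mxE; apply: ball_sym; exact: (gP (i, j)).
apply: bigcupT_measurable => k; rewrite /F.
case: unpickle => // q; case: ifP => // _.
rewrite (_ : _ @^-1` _ = \big[setI/setT]_(i < m) \big[setI/setT]_(j < n)
    ((fun t => f t i j) @^-1` ball (ratr (q.1 i j) : R) (ratr q.2))).
  apply: bigsetI_measurable => i _; apply: bigsetI_measurable => j _.
  rewrite -[X in measurable X]setTI; apply: mf => //.
  by apply: open_measurable; exact: ball_open.
apply/seteqP; split=> t.
  move=> bt; rewrite -bigcap_seq => i _; rewrite -bigcap_seq => j _.
  exact: bt.
rewrite -bigcap_seq => bt i j.
have := bt i; rewrite /= mem_index_enum -bigcap_seq => /(_ isT j) /=.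
by rewrite mem_index_enum => /(_ isT).
Qed.

End measurable_matrix.

Section euclidean.
Variable R : realType.

Definition norm2 k (x : 'cV[R]_k) : R := Num.sqrt (\sum_i x i 0 ^+ 2).

Definition sqnorm2 k (x : 'cV[R]_k) : R := norm2 x ^+ 2.

Definition hadamard k (x y : 'cV[R]_k) : 'cV[R]_k := \col_i (x i 0 * y i 0).

Definition is_moore_penrose p q (L : 'M[R]_(p, q)) (X : 'M[R]_(q, p)) :=
  [/\ L *m X *m L = L, X *m L *m X = X,
      (L *m X)^T = L *m X & (X *m L)^T = X *m L].

Lemma moore_penrose_unique p q (L : 'M[R]_(p, q)) X Y :
  is_moore_penrose L X -> is_moore_penrose L Y -> X = Y.
Proof.
move=> [LXL XLX LXt XLt] [LYL YLY LYt YLt].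
have XE : X *m L = Y *m L.
  rewrite -XLt -{1}LYL -!mulmxA mulmxA trmx_mul XLt YLt.
  by rewrite -mulmxA (mulmxA L) LXL.
have LE : L *m X = L *m Y.
  rewrite -LXt -{1}LYL -mulmxA trmx_mul LXt LYt.
  by rewrite mulmxA LXL.
by rewrite -XLX XE -mulmxA LE mulmxA YLY.
Qed.

Lemma gram_unitmx p q (F : 'M[R]_(p, q)) : row_free F -> F *m F^T \in unitmx.
Proof.
move=> Ffree; rewrite -row_free_unit -kermx_eq0; apply/eqP/row_matrixP => i.
rewrite row0; set v := row i _.
have vFF : v *m (F *m F^T) = 0.
  by rewrite /v -row_mul mulmx_ker row0.
have w0 : (v *m F) *m (v *m F)^T = 0.
  by rewrite trmx_mul mulmxA -(mulmxA v) vFF mul0mx.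
apply/eqP; rewrite -(mulmx_free_eq0 _ Ffree).
move: (v *m F) w0 => w /matrixP/(_ 0 0).
rewrite !mxE; under eq_bigr do rewrite mxE -expr2.
move/eqP; rewrite psumr_eq0 => [/allP w0|j _]; last exact: sqr_ge0.
apply/eqP/rowP => j; have := w0 j; rewrite mem_index_enum => /(_ isT) /=.
by rewrite mxE sqrf_eq0 => /eqP.
Qed.

Lemma moore_penrose_exists p q (L : 'M[R]_(p, q)) :
  exists X, is_moore_penrose L X.
Proof.
have := row_base_free L; have := col_base_full L; have := mulmx_base L.
move: (\rank L) (col_base L) (row_base L) => k C F LE Cfull Ffree.
have FU : F *m F^T \in unitmx by exact: gram_unitmx.
have CU : C^T *m C \in unitmx.
  rewrite -{2}(trmxK C); apply: gram_unitmx.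
  by rewrite /row_free mxrank_tr.
pose U := invmx (F *m F^T); pose V := invmx (C^T *m C).
have LX : L *m (F^T *m U *m V *m C^T) = C *m V *m C^T.
  by rewrite -LE !mulmxA -(mulmxA C F F^T) -(mulmxA C _ U) mulmxV// mulmx1.
have XL : F^T *m U *m V *m C^T *m L = F^T *m U *m F.
  by rewrite -LE !mulmxA -(mulmxA _ C^T C) -(mulmxA _ V) mulVmx// mulmx1.
exists (F^T *m U *m V *m C^T); split.
- by rewrite LX -LE !mulmxA -(mulmxA _ C^T C) -(mulmxA C V) mulVmx// mulmx1.
- by rewrite XL !mulmxA -(mulmxA _ F F^T) -(mulmxA F^T U) mulVmx// mulmx1.
- by rewrite LX !trmx_mul trmxK /V trmx_inv trmx_mul trmxK mulmxA.
- by rewrite XL !trmx_mul trmxK /U trmx_inv trmx_mul trmxK mulmxA.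
Qed.

Definition moore_penrose p q (L : 'M[R]_(p, q)) : 'M[R]_(q, p) :=
  xget 0 [set X | is_moore_penrose L X].

Lemma moore_penroseP p q (L : 'M[R]_(p, q)) :
  is_moore_penrose L (moore_penrose L).
Proof.
exact: (@xgetPex _ 0 [set X | is_moore_penrose L X] (moore_penrose_exists L)).
Qed.

(* Square roots of the eigenvalues of A^T A. *)
Definition singular_values p q (A : 'M[R]_(p, q)) : set R :=
  [set s | 0 <= s /\ eigenvalue (A^T *m A) (s ^+ 2)].

(* For q > 0 the set is finite and nonempty; for q = 0 this is [sup set0 = 0]. *)
Definition sigma_max p q (A : 'M[R]_(p, q)) : R := sup (singular_values A).

End euclidean.

Section measurable_operations.
Variable R : realType.

Lemma measurable_mulmx p q (L : 'M[R]_(p, q)) :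
  measurable_fun setT (mulmx L : 'cV[R]_q -> 'cV[R]_p).
Proof.
apply/measurable_fun_mxP => i j; under eq_fun do rewrite mxE.
by apply: measurable_sum => k; apply: measurable_funM => //; exact: measurable_coord.
Qed.

HB.instance Definition _ p q (L : 'M[R]_(p, q)) :=
  isMeasurableFun.Build _ _ _ _ (mulmx L : 'cV[R]_q -> 'cV[R]_p)
    (measurable_mulmx L).

Definition add_pair k (z : 'cV[R]_k * 'cV[R]_k) := z.1 + z.2.

Definition hadamard_pair k (z : 'cV[R]_k * 'cV[R]_k) := hadamard z.1 z.2.

Lemma measurable_add_pair k : measurable_fun setT (@add_pair k).
Proof.
apply/measurable_fun_mxP => i j; under eq_fun do rewrite mxE.
apply: measurable_funD.
- exact: (measurableT_comp (measurable_coord i j) measurable_fst).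
- exact: (measurableT_comp (measurable_coord i j) measurable_snd).
Qed.

Lemma measurable_hadamard_pair k : measurable_fun setT (@hadamard_pair k).
Proof.
apply/measurable_fun_mxP => i j; under eq_fun do rewrite mxE.
apply: measurable_funM.
- exact: (measurableT_comp (measurable_coord i 0) measurable_fst).
- exact: (measurableT_comp (measurable_coord i 0) measurable_snd).
Qed.

HB.instance Definition _ k :=
  isMeasurableFun.Build _ _ _ _ (@add_pair k) (@measurable_add_pair k).

HB.instance Definition _ k :=
  isMeasurableFun.Build _ _ _ _ (@hadamard_pair k) (@measurable_hadamard_pair k).

End measurable_operations.

Section probability_on_vectors.
Variable R : realType.
Local Open Scope ereal_scope.

Definition prob_delta k (x : 'cV[R]_k) : probability 'cV[R]_k R := \d_x.

Definition prob_push p q (L : 'M[R]_(p, q)) (P : probability 'cV[R]_q R) :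
  probability 'cV[R]_p R := distribution P (mulmx L : 'cV[R]_q -> 'cV[R]_p).

Definition prob_conv k (P Q : probability 'cV[R]_k R) : probability 'cV[R]_k R :=
  distribution (P \x Q) (@add_pair R k).

Definition prob_odot k (P Q : probability 'cV[R]_k R) : probability 'cV[R]_k R :=
  distribution (P \x Q) (@hadamard_pair R k).

Definition second_moment k (P : probability 'cV[R]_k R) : \bar R :=
  \int[P]_x (sqnorm2 x)%:E.

Definition couplings k (P Q : probability 'cV[R]_k R) :
    set (probability ('cV[R]_k * 'cV[R]_k)%type R) :=
  [set g | forall S, measurable S ->
     g (fst @^-1` S) = P S /\ g (snd @^-1` S) = Q S].

Definition wasserstein k (c : 'cV[R]_k -> R) (P Q : probability 'cV[R]_k R) :
    \bar R :=
  ereal_inf [set \int[g]_z (c (z.1 - z.2)%R)%:E | g in couplings P Q].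

(* The radius is extended-real: an infinite radius gives all distributions. *)
Definition wball k (c : 'cV[R]_k -> R) (eps : \bar R)
    (P : probability 'cV[R]_k R) : set (probability 'cV[R]_k R) :=
  [set Q | wasserstein c P Q <= eps].

End probability_on_vectors.

Section random_vectors.
Context d (Omega : measurableType d) (R : realType).
Variable Pr : probability Omega R.

Definition has_law k (X : {RV Pr >-> 'cV[R]_k}) (Q : probability 'cV[R]_k R) :=
  forall S, measurable S -> distribution Pr X S = Q S.

Definition independent3 p q k (X : {RV Pr >-> 'cV[R]_p})
    (Y : {RV Pr >-> 'cV[R]_q}) (Z : {RV Pr >-> 'cV[R]_k}) :=
  forall S T U, measurable S -> measurable T -> measurable U ->
    Pr (X @^-1` S `&` Y @^-1` T `&` Z @^-1` U) =
    (Pr (X @^-1` S) * Pr (Y @^-1` T) * Pr (Z @^-1` U))%E.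

End random_vectors.

Section block_trajectories.
Variable R : realType.

(* [B, A B, ..., A^(t-1) B] *)
Definition power_blocks n k t (A : 'M[R]_n) (B : 'M[R]_(n, k)) :
  'M[R]_(n, \sum_(i < t) k) := \mxrow_(i < t) (A ^+ i *m B).

(* [v_(t-1); v_(t-2); ...; v_0]: most recent block first. *)
Definition stack k t (v : nat -> 'cV[R]_k) : 'cV[R]_(\sum_(i < t) k) :=
  \mxcol_(i < t) v (t - i.+1)%N.

Context d (Omega : measurableType d) (Pr : probability Omega R).

Definition stack_rv k t (w : nat -> {RV Pr >-> 'cV[R]_k}) (omega : Omega) :=
  stack t (fun s => w s omega).

Lemma measurable_stack_rv k t (w : nat -> {RV Pr >-> 'cV[R]_k}) :
  measurable_fun setT (stack_rv t w).
Proof.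
apply/measurable_fun_mxP => i j; under eq_fun do rewrite mxE.
apply: (measurableT_comp (measurable_coord _ _)).
exact: measurable_funP.
Qed.

HB.instance Definition _ k t (w : nat -> {RV Pr >-> 'cV[R]_k}) :=
  isMeasurableFun.Build _ _ _ _ (stack_rv t w) (measurable_stack_rv w).

End block_trajectories.

Section multiplicative_noise.
Variables (R : realType) (n m : nat) (A : 'M[R]_n) (B : 'M[R]_(n, m)).
Variables (u : nat -> 'cV[R]_m) (x0 : 'cV[R]_n).
Variables (eps1 eps2 : R) (P1 P2 : probability 'cV[R]_n R).

Fixpoint mult_center t : probability 'cV[R]_n R :=
  if t is s.+1 then
    prob_conv (prob_odot P1 (prob_push A (mult_center s))) (prob_odot P2 (prob_delta (B *m u s)))
  else prob_delta x0.

Local Open Scope ereal_scope.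

(* Extended-real, since second moments may be infinite; 0 * +oo = 0. *)
Fixpoint mult_radius t : \bar R :=
  if t is s.+1 then
    (sqrte (eps1%:E * mult_radius s) * (sigma_max A)%:E
     + sqrte (mult_radius s * second_moment P1) * (sigma_max A)%:E
     + sqrte (eps1%:E * second_moment (prob_push A (mult_center s)))
     + (Num.sqrt eps2 * norm2 (B *m u s))%:E) ^+ 2
  else 0.

End multiplicative_noise.

(* Main.v *)
Require Import Defs.
From HB Require Import structures.
From mathcomp Require Import all_boot all_order all_algebra.
From mathcomp Require Import all_classical all_reals all_analysis.
From mathcomp Require Import measurable_realfun ring lra.

Set Implicit Arguments.
Unset Strict Implicit.
Unset Printing Implicit Defensive.

Import Order.TTheory GRing.Theory Num.Theory.
Import numFieldNormedType.Exports.

Local Open Scope classical_set_scope.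
Local Open Scope ring_scope.

(** In all three parts the law of the state is the image, under a measurable
    map, of laws lying in known Wasserstein balls, and a coupling of the inputs
    is pushed through that map to couple the outputs.

    For the linear systems the map is [x |-> b + L x], where [L] is [A ^+ t]
    or the row of blocks [D, A D, ...], and [b] collects the deterministic
    terms ([linear_recurrence], [power_blocks_stack]). The cost
    [|L^+ (L x - L y)|^2] is at most [|x - y|^2] because [L^+ L] is an
    orthogonal projection, so images of balls lie in balls of the same radius
    ([wball_affine]).

    For the multiplicative system one step maps an independent triple (first
    noise, state, second noise) to the next state, and couplings of the three
    components are combined independently. The difference of the two outputs
    is a sum of four terms, each bounded by a product of independent factors
    ([norm2_mult_step_diff]); Minkowski's inequality in L2, independence and
    [|A v| <= sigma_max A * |v|] ([sigma_maxP]) bound the cost by an expression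
    that becomes the next radius when the three transport costs equal the
    given radii ([mult_step_cost]). Induction on time iterates the estimate
    ([wball_mult_center]).

    Optimal couplings are replaced by couplings whose cost is within a factor
    [K > 1] of the radius ([near_optimal_coupling]); the bound is homogeneous,
    so [K] can be sent to 1 ([wball_mult_step]). This works with infinite
    moments and radii and the convention [0 * +oo = 0] because a radius 0 is
    matched exactly: two laws at squared distance 0 agree on closed sets, hence
    on all measurable sets, and the diagonal coupling has cost 0. *)

(** * Euclidean norm, Moore-Penrose inverse and largest singular value *)

Section euclidean_norm.
Variable R : realType.
Implicit Types (k : nat).

Lemma sqnorm2E k (x : 'cV[R]_k) : sqnorm2 x = \sum_i x i 0 ^+ 2.
Proof. by rewrite /sqnorm2 sqr_sqrtr// sumr_ge0// => i _; exact: sqr_ge0. Qed.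

Lemma sqnorm2_trmx k (x : 'cV[R]_k) : sqnorm2 x = (x^T *m x) 0 0.
Proof. by rewrite sqnorm2E mxE; apply: eq_bigr => i _; rewrite mxE expr2. Qed.

Lemma norm2_ge0 k (x : 'cV[R]_k) : 0 <= norm2 x.
Proof. exact: sqrtr_ge0. Qed.

Lemma sqnorm2_ge0 k (x : 'cV[R]_k) : 0 <= sqnorm2 x.
Proof. exact: sqr_ge0. Qed.

Lemma norm2E k (x : 'cV[R]_k) : norm2 x = Num.sqrt (sqnorm2 x).
Proof. by rewrite /sqnorm2 sqrtr_sqr ger0_norm// norm2_ge0. Qed.

Lemma norm2_0 k : norm2 (0 : 'cV[R]_k) = 0.
Proof. by rewrite norm2E sqnorm2E big1 ?sqrtr0// => i _; rewrite mxE expr0n. Qed.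

Lemma sqnorm2_eq0 k (x : 'cV[R]_k) : sqnorm2 x = 0 -> x = 0.
Proof.
rewrite sqnorm2E => /eqP; rewrite psumr_eq0 => [/allP x0|i _]; last exact: sqr_ge0.
apply/matrixP => i j; rewrite ord1 mxE; apply/eqP.
by have := x0 i; rewrite mem_index_enum sqrf_eq0; apply.
Qed.

Lemma norm2_coord k (x : 'cV[R]_k) i : `|x i 0| <= norm2 x.
Proof.
rewrite -sqrtr_sqr norm2E ler_wsqrtr// sqnorm2E (bigD1 i)//= lerDl.
by rewrite sumr_ge0// => j _; exact: sqr_ge0.
Qed.

Lemma sqnorm2D k (x y : 'cV[R]_k) :
  sqnorm2 (x + y) = sqnorm2 x + 2 * (x^T *m y) 0 0 + sqnorm2 y.
Proof.
rewrite !sqnorm2E mxE mulr_sumr -!big_split/=.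
by apply: eq_bigr => i _; rewrite !mxE; ring.
Qed.

Lemma sqnorm2Z k a (x : 'cV[R]_k) : sqnorm2 (a *: x) = a ^+ 2 * sqnorm2 x.
Proof. by rewrite !sqnorm2E mulr_sumr; apply: eq_bigr => i _; rewrite mxE exprMn. Qed.

Lemma norm2N k (x : 'cV[R]_k) : norm2 (- x) = norm2 x.
Proof. by rewrite !norm2E -scaleN1r sqnorm2Z sqrrN expr1n mul1r. Qed.

Lemma sqnorm2N k (x : 'cV[R]_k) : sqnorm2 (- x) = sqnorm2 x.
Proof. by rewrite /sqnorm2 norm2N. Qed.

Lemma cauchy_schwarz k (x y : 'cV[R]_k) : (x^T *m y) 0 0 <= norm2 x * norm2 y.
Proof.
have [x0|xN0] := eqVneq (norm2 x) 0.
  rewrite (sqnorm2_eq0 (x := x)); last by rewrite /sqnorm2 x0 expr0n.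
  by rewrite trmx0 mul0mx mxE norm2_0 mul0r.
have [y0|yN0] := eqVneq (norm2 y) 0.
  rewrite (sqnorm2_eq0 (x := y)); last by rewrite /sqnorm2 y0 expr0n.
  by rewrite mulmx0 mxE norm2_0 mulr0.
have a0 : 0 < norm2 x by rewrite lt_def xN0 norm2_ge0.
have b0 : 0 < norm2 y by rewrite lt_def yN0 norm2_ge0.
have := sqnorm2_ge0 (norm2 y *: x + (- norm2 x) *: y).
rewrite sqnorm2D !sqnorm2Z [(_ *: x)^T]linearZ/= -scalemxAl -scalemxAr !mxE /sqnorm2.
set s := \sum_j _; set a := norm2 x in a0 *; set b := norm2 y in b0 *.
have -> : b ^+ 2 * a ^+ 2 + 2 * (b * (- a * s)) + (- a) ^+ 2 * b ^+ 2
  = 2 * (a * b) * (a * b - s) by ring.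
by rewrite pmulr_rge0 ?subr_ge0// !mulr_gt0.
Qed.

Lemma norm2D k (x y : 'cV[R]_k) : norm2 (x + y) <= norm2 x + norm2 y.
Proof.
rewrite -(ler_pXn2r (ltn0Sn 1)) ?nnegrE ?addr_ge0 ?norm2_ge0//.
rewrite -/(sqnorm2 (x + y)) sqnorm2D sqrrD /sqnorm2.
by have := cauchy_schwarz x y; lra.
Qed.

Lemma norm2_hadamard k (x y : 'cV[R]_k) :
  norm2 (hadamard x y) <= norm2 x * norm2 y.
Proof.
rewrite -(ler_pXn2r (ltn0Sn 1)) ?nnegrE ?mulr_ge0 ?norm2_ge0//.
rewrite exprMn -!/(sqnorm2 _) !sqnorm2E mulr_suml ler_sum// => i _.
rewrite mxE exprMn ler_wpM2l ?sqr_ge0//.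
by rewrite -sqnorm2E -(ler_sqrt _ (sqnorm2_ge0 _)) sqrtr_sqr -norm2E norm2_coord.
Qed.

(** [E = L^+ L] is a symmetric idempotent, so [E v] and [v - E v] are
    orthogonal and Pythagoras gives the bound. This is the only property of
    the pseudo-inverse that transports of [x |-> b + L x] need. *)
Lemma moore_penrose_contraction p q (L : 'M[R]_(p, q)) v :
  sqnorm2 (moore_penrose L *m (L *m v)) <= sqnorm2 v.
Proof.
have [_ XLX _ XLt] := moore_penroseP L.
rewrite mulmxA; set E := moore_penrose L *m L in XLt *.
have EE : E *m E = E by rewrite /E mulmxA XLX.
move: E XLt EE => E Et EE.
rewrite -[in leRHS](subrK (E *m v) v) sqnorm2D [X in 2 * X](_ : _ = 0).
  by rewrite mulr0 addr0 lerDr sqnorm2_ge0.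
rewrite linearB/= trmx_mul Et mulmxBl -!mulmxA.
by rewrite [in X in _ - X](mulmxA E) EE subrr mxE.
Qed.

End euclidean_norm.

Section spectral_norm.
Variable R : realType.

Lemma continuous_sqnorm2_mulmx p q (A : 'M[R]_(p, q)) :
  continuous (fun v : 'rV[R]_q => sqnorm2 (A *m v^T)).
Proof.
rewrite (_ : (fun v : 'rV[R]_q => sqnorm2 (A *m v^T)) =
    fun v => \sum_i (\sum_j A i j * v 0 j) ^+ 2); last first.
  apply/funext => v; rewrite sqnorm2E; apply: eq_bigr => i _.
  by rewrite mxE; congr (_ ^+ 2); apply: eq_bigr => j _; rewrite mxE.
have addc : continuous (fun z : R * R => z.1 + z.2) by exact: add_continuous.
refine (continuous_big addc _) => i _ v.
apply: (@continuous_comp _ _ _ _ (fun x : R => x ^+ 2)); last first.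
  exact: exprn_continuous.
move: v; refine (continuous_big addc _) => j _ v.
by apply: continuousM; [exact: cst_continuous|exact: coord_continuous].
Qed.

(** First-order optimality: along [w = c S] the nonnegative polynomial
    [t |-> q (c + t w)] vanishes at 0, so its linear coefficient
    [2 * |w|^2] must be 0. *)
Lemma psd_isotropic k (S : 'M[R]_k) (c : 'rV[R]_k) : S^T = S ->
  (forall v : 'rV[R]_k, 0 <= (v *m S *m v^T) 0 0) -> (c *m S *m c^T) 0 0 = 0 ->
  c *m S = 0.
Proof.
move=> St Spsd cSc; set w := c *m S.
have wE : w^T = S *m c^T by rewrite /w trmx_mul St.
set H := (w *m S *m w^T) 0 0; set b := (w *m w^T) 0 0.
have H0 : 0 <= H by exact: Spsd.
have b0 : 0 <= b by rewrite /b -{1}(trmxK w) -sqnorm2_trmx sqnorm2_ge0.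
have expand t : 0 <= 2 * t * b + t ^+ 2 * H.
  have := Spsd (c + t *: w).
  have -> : (c + t *: w) *m S *m (c + t *: w)^T = c *m S *m c^T
      + (2 * t) *: (w *m w^T) + (t ^+ 2) *: (w *m S *m w^T).
    rewrite [(c + t *: w)^T]linearD/= [(t *: w)^T]linearZ/=.
    rewrite mulmxDl -scalemxAl mulmxDr !mulmxDl -!scalemxAr -!scalemxAl -/w.
    rewrite scalerA -expr2 addrA; congr (_ + _); rewrite -!addrA; congr (_ + _).
    by rewrite -[w *m S *m c^T]mulmxA -wE -scalerDl mulr2n mulrDl mul1r.
  by rewrite mxE [X in X + _]mxE cSc add0r mxE [X in _ + X]mxE.
have b_eq0 : b = 0.
  apply/eqP; rewrite eq_le b0 andbT leNgt; apply/negP => bgt0.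
  (* a step small enough for the linear term to beat the quadratic one; the
     denominator is H + 1 because H itself may be 0 *)
  have := expand (- b / (H + 1)); rewrite leNgt => /negP; apply.
  have H1 : H + 1 != 0 by rewrite gt_eqF// ltr_wpDl.
  have -> : 2 * (- b / (H + 1)) * b + (- b / (H + 1)) ^+ 2 * H
    = - ((b / (H + 1)) ^+ 2 * (H + 2)) by field.
  by rewrite oppr_lt0 mulr_gt0 ?exprn_gt0 ?divr_gt0 ?ltr_wpDl.
have : w^T = 0 by apply: sqnorm2_eq0; rewrite sqnorm2_trmx trmxK.
by move/(congr1 trmx); rewrite trmxK trmx0.
Qed.

(** A maximiser [c] of [|A x|^2] on the compact unit sphere satisfies
    [|A x|^2 <= l * |x|^2] for all [x], with [l = |A c|^2]. Hence [l - A^T A]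
    is positive semidefinite and isotropic at [c], so [c] is an eigenvector
    and [sqrt l] a singular value; the same bound shows that no singular
    value exceeds [sqrt l], which makes the supremum meaningful. *)
Lemma sigma_maxP p q (A : 'M[R]_(p, q)) (v : 'cV[R]_q) :
  norm2 (A *m v) <= sigma_max A * norm2 v.
Proof.
case: q A v => [|q] A v.
  by rewrite (_ : v = 0) ?mulmx0 ?norm2_0 ?mulr0//; apply/matrixP => -[].
pose sphere := [set x : 'rV[R]_q.+1 | sqnorm2 x^T = 1].
have sphere0 : sphere !=set0.
  exists (delta_mx 0 0); rewrite /sphere /= sqnorm2E (bigD1 0)//= big1 => [|i i0].
    by rewrite !mxE eqxx expr1n addr0.
  by rewrite !mxE/= (negbTE i0) expr0n.
have sphere_compact : compact sphere.
  apply: bounded_closed_compact.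
    exists 1; split => // M M1 x; rewrite /sphere /= => x1.
    apply: le_trans (ltW M1); rewrite [`|x|]mx_normrE.
    apply/bigmax_leP; split => //= -[i j] _ /=; rewrite ord1.
    by have := norm2_coord x^T j; rewrite mxE norm2E x1 sqrtr1.
  have -> : sphere = (fun x : 'rV[R]_q.+1 => sqnorm2 (1%:M *m x^T)) @^-1` [set 1].
    by apply/seteqP; split => x; rewrite /sphere/= mul1mx.
  apply: closed_comp => [x _|]; first exact: continuous_sqnorm2_mulmx.
  exact: closed_eq.
have [|c] := @compact_EVT_max _ R (fun x => sqnorm2 (A *m x^T)) _ sphere0 sphere_compact.
  by apply: continuous_subspaceT; exact: continuous_sqnorm2_mulmx.
rewrite inE /sphere/= => c1 cmax.
set l := sqnorm2 (A *m c^T) in cmax.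
have l0 : 0 <= l by exact: sqnorm2_ge0.
have bound (x : 'cV[R]_q.+1) : sqnorm2 (A *m x) <= l * sqnorm2 x.
  have [/sqnorm2_eq0 ->|xN0] := eqVneq (sqnorm2 x) 0.
    by rewrite mulmx0 !sqnorm2E !big1 ?mulr0// => i _; rewrite mxE expr0n.
  have nxN0 : norm2 x != 0 by move: xN0; rewrite /sqnorm2 sqrf_eq0.
  have /cmax : ((norm2 x)^-1 *: x)^T \in sphere.
    by rewrite inE /sphere/= trmxK sqnorm2Z /sqnorm2 exprVn mulVf// expf_neq0.
  rewrite trmxK -scalemxAr sqnorm2Z exprVn ler_pdivrMl 1?mulrC//.
  by rewrite exprn_gt0// lt_def nxN0 norm2_ge0.
have sv_bound s : singular_values A s -> s <= Num.sqrt l.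
  move=> [s0 /eigenvalueP[w wA wN0]].
  rewrite -(ler_pXn2r (ltn0Sn 1)) ?nnegrE ?sqrtr_ge0// sqr_sqrtr//.
  have w0 : 0 < sqnorm2 w^T.
    rewrite lt_def sqnorm2_ge0 andbT; apply: contra_neq wN0 => /sqnorm2_eq0.
    by move/(congr1 trmx); rewrite trmxK trmx0.
  rewrite -(ler_pM2r w0); apply: le_trans (bound w^T).
  by rewrite !sqnorm2_trmx trmx_mul !trmxK mulmxA -(mulmxA w) wA -scalemxAl [in leRHS]mxE.
have sv_l : singular_values A (Num.sqrt l).
  split; first exact: sqrtr_ge0.
  rewrite sqr_sqrtr//; apply/eigenvalueP; exists c; last first.
    apply/eqP => c0; move: c1; rewrite c0 trmx0 /sqnorm2 norm2_0 expr0n/= => /eqP.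
    by rewrite eq_sym oner_eq0.
  pose S := l%:M - A^T *m A.
  have SE (x : 'rV[R]_q.+1) :
      (x *m S *m x^T) 0 0 = l * sqnorm2 x^T - sqnorm2 (A *m x^T).
    rewrite /S mulmxBr mulmxBl mul_mx_scalar -scalemxAl mxE [X in X + _]mxE.
    by rewrite [X in _ + X]mxE !sqnorm2_trmx trmx_mul !trmxK !mulmxA.
  have : c *m S = 0.
    apply: psd_isotropic.
    - by rewrite /S linearB/= tr_scalar_mx trmx_mul trmxK.
    - by move=> x; rewrite SE subr_ge0 bound.
    - by rewrite SE c1 mulr1 subrr.
  by rewrite /S mulmxBr mul_mx_scalar => /eqP; rewrite subr_eq0 => /eqP.
have le_l : Num.sqrt l <= sigma_max A.
  by apply: ub_le_sup => //; exists (Num.sqrt l) => s /sv_bound.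
apply: (@le_trans _ _ (Num.sqrt l * norm2 v)); last by rewrite ler_wpM2r ?norm2_ge0.
by rewrite !norm2E -sqrtrM// ler_wsqrtr.
Qed.

End spectral_norm.

(** When the set of singular values has no supremum, [sup] is 0. *)
Lemma sigma_max_ge0 (R : realType) p q (A : 'M[R]_(p, q)) : 0 <= sigma_max A.
Proof.
have [sv|nsv] := pselect (has_sup (singular_values A));
  last by rewrite /sigma_max sup_out.
by have [[s sA] ub] := sv; apply: (le_trans (proj1 sA)); exact: ub_le_sup.
Qed.

(** * Laws and product laws *)

Section laws.
Variable R : realType.

(** Equality on measurable sets only: a probability is a function on all
    sets, and its values on nonmeasurable ones carry no information. *)
Definition same_law d (T : measurableType d) (P Q : probability T R) :=
  forall S, measurable S -> P S = Q S.

(** [distribution] takes a bundled measurable map; this variant accepts the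
    map and its measurability proof separately. *)
Definition law d d' (T : measurableType d) (T' : measurableType d')
    (P : probability T R) (f : T -> T') (mf : measurable_fun setT f) :
    probability T' R :=
  distribution P (HB.pack_for {mfun T >-> T'} f
    (isMeasurableFun.Build _ _ _ _ f mf)).

Lemma measurable_preimage d d' (T : measurableType d) (T' : measurableType d')
    (f : T -> T') (S : set T') :
  measurable_fun setT f -> measurable S -> measurable (f @^-1` S).
Proof. by move=> mf mS; rewrite -[X in measurable X]setTI; exact: mf. Qed.

Lemma ge0_integral_law d d' (T : measurableType d) (T' : measurableType d')
    (P : probability T R) (f : T -> T') (mf : measurable_fun setT f)
    (c : T' -> R) : measurable_fun setT c -> (forall x, 0 <= c x) ->
  (\int[law P mf]_x (c x)%:E = \int[P]_x (c (f x))%:E)%E.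
Proof.
move=> mc c0; rewrite ge0_integral_distribution//; exact/measurable_EFinP.
Qed.

Lemma eq_law_integral d (T : measurableType d) (P Q : probability T R)
    (c : T -> \bar R) :
  same_law P Q -> (\int[P]_x c x = \int[Q]_x c x)%E.
Proof. by move=> PQ; apply: eq_measure_integral => A mA _; exact: PQ. Qed.

Section product.
Context d1 d2 (T1 : measurableType d1) (T2 : measurableType d2).
Implicit Types (P : probability T1 R) (Q : probability T2 R).

Lemma same_law_product P Q (m : probability (T1 * T2)%type R) :
  (forall S1 S2, measurable S1 -> measurable S2 ->
    m (S1 `*` S2) = (P S1 * Q S2)%E) ->
  same_law (P \x Q)%E m.
Proof. by move=> mE S mS; exact: product_measure_unique. Qed.

Lemma same_law_prod P P' Q Q' : same_law P P' -> same_law Q Q' ->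
  same_law (P \x Q)%E (P' \x Q')%E.
Proof.
move=> PP' QQ'; apply: same_law_product => S1 S2 mS1 mS2.
by rewrite PP'// QQ'//; exact: product_measure1E.
Qed.

Lemma ge0_integral_product1 P Q (c : T1 -> R) :
  measurable_fun setT c -> (forall x, 0 <= c x) ->
  (\int[P \x Q]_z (c z.1)%:E = \int[P]_x (c x)%:E)%E.
Proof.
move=> mc c0; rewrite fubini_tonelli1; first last.
- by move=> z; rewrite lee_fin.
- by apply/measurable_EFinP; exact: (measurableT_comp mc).
apply: eq_integral => x _; rewrite [LHS](integral_cst Q measurableT (c x)%:E).
by rewrite [X in (_ * X)%E]probability_setT mule1.
Qed.

Lemma ge0_integral_product2 P Q (c : T2 -> R) :
  measurable_fun setT c -> (forall x, 0 <= c x) ->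
  (\int[P \x Q]_z (c z.2)%:E = \int[Q]_x (c x)%:E)%E.
Proof.
move=> mc c0; rewrite fubini_tonelli1; first last.
- by move=> z; rewrite lee_fin.
- by apply/measurable_EFinP; exact: (measurableT_comp mc).
rewrite [LHS](integral_cst P measurableT (\int[Q]_x (c x)%:E)%E).
by rewrite [X in (_ * X)%E]probability_setT mule1.
Qed.

(** The product is taken in the extended reals, with [0 * +oo = 0], so the
    identity holds for infinite integrals too. *)
Lemma ge0_integral_productM P Q (f : T1 -> R) (h : T2 -> R) :
  measurable_fun setT f -> measurable_fun setT h ->
  (forall x, 0 <= f x) -> (forall x, 0 <= h x) ->
  (\int[P \x Q]_z (f z.1 * h z.2)%:E =
   \int[P]_x (f x)%:E * \int[Q]_x (h x)%:E)%E.
Proof.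
move=> mf mh f0 h0; rewrite fubini_tonelli1; first last.
- by move=> z; rewrite lee_fin mulr_ge0.
- by apply/measurable_EFinP/measurable_funM;
    [exact: (measurableT_comp mf)|exact: (measurableT_comp mh)].
rewrite -ge0_integralZr//; first last.
- by apply: integral_ge0 => x _; rewrite lee_fin.
- by move=> x _; rewrite lee_fin.
- exact/measurable_EFinP.
apply: eq_integral => x _; rewrite /fubini_F -ge0_integralZl//=.
- exact/measurable_EFinP.
- by move=> y _; rewrite lee_fin.
- by rewrite lee_fin.
Qed.

End product.

Lemma measurable_map_pair d1 d2 (T1 : measurableType d1)
    (T2 : measurableType d2) d1' d2' (T1' : measurableType d1')
    (T2' : measurableType d2') (f : T1 -> T1') (h : T2 -> T2') :
  measurable_fun setT f -> measurable_fun setT h ->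
  measurable_fun setT (fun z : T1 * T2 => (f z.1, h z.2)).
Proof.
by move=> mf mh; apply: measurable_fun_pair; [exact: (measurableT_comp mf)|
  exact: (measurableT_comp mh)].
Qed.

Lemma law_product d1 d2 (T1 : measurableType d1)
    (T2 : measurableType d2) d1' d2' (T1' : measurableType d1')
    (T2' : measurableType d2') (P : probability T1 R) (Q : probability T2 R)
    (f : T1 -> T1') (h : T2 -> T2')
    (mf : measurable_fun setT f) (mh : measurable_fun setT h)
    (mfh : measurable_fun setT (fun z : T1 * T2 => (f z.1, h z.2))) :
  same_law (law P mf \x law Q mh)%E (law (P \x Q)%E mfh).
Proof.
apply: same_law_product => S1 S2 mS1 mS2.
exact: (product_measure1E P Q (measurable_preimage mf mS1)
  (measurable_preimage mh mS2)).
Qed.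

End laws.

(** * Couplings and transport cost *)

Section couplings.
Variable R : realType.
Implicit Types k : nat.

Lemma measurable_sqnorm2 k : measurable_fun setT (@sqnorm2 R k).
Proof.
rewrite (_ : @sqnorm2 R k = fun x => \sum_i x i 0 ^+ 2); last first.
  by apply/funext => x; exact: sqnorm2E.
by apply: measurable_sum => i; apply: measurable_funX; exact: measurable_coord.
Qed.

Lemma measurable_norm2 k : measurable_fun setT (@norm2 R k).
Proof.
rewrite (_ : @norm2 R k = fun x => Num.sqrt (sqnorm2 x)); last first.
  by apply/funext => x; exact: norm2E.
exact: (measurableT_comp (continuous_measurable_fun (@sqrt_continuous R))
  (@measurable_sqnorm2 k)).
Qed.

Lemma measurable_diff k :
  measurable_fun setT (fun z : 'cV[R]_k * 'cV[R]_k => z.1 - z.2).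
Proof.
apply/measurable_fun_mxP => i j; under eq_fun do rewrite !mxE.
apply: measurable_funB.
- exact: (measurableT_comp (measurable_coord i j) measurable_fst).
- exact: (measurableT_comp (measurable_coord i j) measurable_snd).
Qed.

Definition transport_cost k (c : 'cV[R]_k -> R)
    (g : probability ('cV[R]_k * 'cV[R]_k)%type R) : \bar R :=
  (\int[g]_z (c (z.1 - z.2)%R)%:E)%E.

Lemma transport_cost_ge0 k (c : 'cV[R]_k -> R) g :
  (forall x, 0 <= c x) -> (0 <= transport_cost c g)%E.
Proof. by move=> c0; apply: integral_ge0 => z _; rewrite lee_fin. Qed.

Lemma transport_cost_law d (T : measurableType d) k (P : probability T R)
    (f : T -> 'cV[R]_k * 'cV[R]_k) (mf : measurable_fun setT f)
    (c : 'cV[R]_k -> R) : measurable_fun setT c -> (forall x, 0 <= c x) ->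
  transport_cost c (law P mf) = (\int[P]_x (c ((f x).1 - (f x).2)%R)%:E)%E.
Proof.
move=> mc c0; rewrite /transport_cost.
rewrite (ge0_integral_law P mf (c := fun z : 'cV_k * 'cV_k => c (z.1 - z.2)))//.
by apply: (measurableT_comp mc); exact: measurable_diff.
Qed.

Lemma couplings_same_law k (P P' Q Q' : probability 'cV[R]_k R) :
  same_law P P' -> same_law Q Q' -> couplings P Q `<=` couplings P' Q'.
Proof. by move=> PP QQ g gPQ S mS; rewrite -PP// -QQ//; exact: gPQ. Qed.

Lemma wasserstein_le k (c : 'cV[R]_k -> R) P Q g :
  couplings P Q g -> (wasserstein c P Q <= transport_cost c g)%E.
Proof. by move=> gPQ; apply: ereal_inf_lbound; exists g. Qed.

Lemma couplings_law k l (f : 'cV[R]_k -> 'cV[R]_l)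
    (mf : measurable_fun setT f)
    (mff : measurable_fun setT (fun z : 'cV_k * 'cV_k => (f z.1, f z.2))) P Q g :
  couplings P Q g -> couplings (law P mf) (law Q mf) (law g mff).
Proof. by move=> gPQ S mS; exact: (gPQ _ (measurable_preimage mf mS)). Qed.

(** Pushing a coupling forward by [f] on both sides couples the images, at
    no larger cost when [f] does not expand [c] into [c']. *)
Lemma wasserstein_law k l (f : 'cV[R]_k -> 'cV[R]_l)
    (mf : measurable_fun setT f) (c : 'cV[R]_k -> R) (c' : 'cV[R]_l -> R)
    (P Q : probability 'cV[R]_k R) (P' Q' : probability 'cV[R]_l R) :
  measurable_fun setT c -> measurable_fun setT c' ->
  (forall x, 0 <= c x) -> (forall x, 0 <= c' x) ->
  (forall x y, c' (f x - f y) <= c (x - y)) ->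
  same_law (law P mf) P' -> same_law (law Q mf) Q' ->
  (wasserstein c' P' Q' <= wasserstein c P Q)%E.
Proof.
move=> mc mc' c0 c'0 cc' PP' QQ'; apply: le_ereal_inf_tmp => _ [g gPQ <-].
have mff := measurable_map_pair mf mf.
apply: le_trans (wasserstein_le c' _) _.
  exact: couplings_same_law PP' QQ' _ (couplings_law mf mff gPQ).
rewrite transport_cost_law//; apply: ge0_le_integral => //=.
- by move=> z _; rewrite lee_fin.
- apply/measurable_EFinP/(measurableT_comp mc').
  exact: (measurableT_comp (@measurable_diff _) mff).
- by apply/measurable_EFinP/(measurableT_comp mc); exact: measurable_diff.
- by move=> z _; rewrite lee_fin.
Qed.

Lemma measurable_swap k :
  measurable_fun setT (fun z : 'cV[R]_k * 'cV[R]_k => (z.2, z.1)).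
Proof. exact: measurable_fun_pair. Qed.

(** If [x] lies in [F] then [y] lies in the open [delta]-neighbourhood of [F]
    unless [|x - y| >= delta], which is improbable by Markov's inequality when
    the cost is small. Letting the cost and then [delta] tend to 0 leaves the
    closure of [F]. *)
Lemma coupling_closed_le k (P Q : probability 'cV[R]_k R) :
  (forall e : R, 0 < e ->
    exists2 g, couplings P Q g & (transport_cost (@sqnorm2 R k) g <= e%:E)%E) ->
  forall F : set 'cV[R]_k, closed F -> (P F <= Q F)%E.
Proof.
move=> small F cF.
pose Fn n := \bigcup_(x in F) ball x (n.+1%:R^-1 : R).
have oFn n : open (Fn n) by apply: bigcup_open => x _; exact: ball_open.
have mF : measurable F.
  rewrite -(setCK F); apply: measurableC; apply: open_measurable_mx.
  exact: closed_openC.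
have mFn n : measurable (Fn n) by exact: open_measurable_mx.
have PQn n : (P F <= Q (Fn n))%E.
  set dlt : R := n.+1%:R^-1.
  have dlt0 : 0 < dlt by rewrite invr_gt0.
  apply/lee_addgt0Pr => e e0.
  have [|g gPQ cost] := small (dlt ^+ 2 * e); first by rewrite mulr_gt0// exprn_gt0.
  pose far := [set z : 'cV[R]_k * 'cV[R]_k |
    ((dlt ^+ 2)%:E <= `|(sqnorm2 (z.1 - z.2)%R)%:E|)%E].
  have mcost : measurable_fun setT
      (fun z : 'cV[R]_k * 'cV[R]_k => (sqnorm2 (z.1 - z.2))%:E).
    apply/measurable_EFinP/(measurableT_comp (@measurable_sqnorm2 _)).
    exact: measurable_diff.
  have mfar : measurable far.
    rewrite -[far]setTI; apply: emeasurable_fun_c_infty => //.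
    exact: measurableT_comp.
  have farP : (g far <= e%:E)%E.
    have := @le_integral_comp_abse _ _ _ g setT measurableT
      (fun z => (sqnorm2 (z.1 - z.2))%:E) (dlt ^+ 2) id (@measurable_id _ _ _)
      (fun r r0 => r0) (fun x y _ _ xy => xy) mcost (exprn_gt0 _ dlt0).
    rewrite setTI -/far => /le_trans; move=> /(_ (dlt ^+ 2 * e)%:E).
    rewrite EFinM lee_pmul2l// ?lte_fin ?exprn_gt0//; apply.
    apply: le_trans cost; rewrite le_eqVlt; apply/orP; left; apply/eqP.
    by apply: eq_integral => z _; rewrite gee0_abs// lee_fin sqnorm2_ge0.
  have [<- _] := gPQ _ mF; have [_ <-] := gPQ _ (mFn n).
  apply: (@le_trans _ _ (g (snd @^-1` Fn n `|` far))).
    apply: le_measure; rewrite ?inE.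
    - exact: measurable_preimage.
    - by apply: measurableU => //; exact: measurable_preimage.
    move=> [x y] /= Fx; have [near|?] := ltP (norm2 (x - y)) dlt; [left|right].
      exists x => //; split => // i j; rewrite /ball/= ord1.
      apply: le_lt_trans near; have := norm2_coord (x - y) i.
      by rewrite !mxE.
    by rewrite /far/= lee_fin ger0_norm ?sqnorm2_ge0// ler_pXn2r//
      nnegrE ?norm2_ge0// ltW.
  apply: le_trans (measureU2 _ _ _) _ => //; first exact: measurable_preimage.
  by rewrite leeD2l.
have capF : \bigcap_n Fn n = F.
  apply/seteqP; split => [y yF|y Fy n _]; last first.
    by exists y => //; apply: ballxx; rewrite invr_gt0.
  apply: cF => B /nbhs_ballP[e /= e0 eB].
  have [n ne] : exists n, n.+1%:R^-1 < e.
    by have [n _ ne] := near_infty_natSinv_lt (PosNum e0); exists n; apply: ne => /=.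
  have [x Fx xy] := yF n I; exists x; split => //; apply: eB.
  by apply: ball_sym; apply: le_ball xy; rewrite ltW.
have : Q \o Fn @ \oo --> Q (\bigcap_n Fn n).
  apply: nonincreasing_cvg_mu => //.
  - by rewrite (le_lt_trans (probability_le1 _ _))// ltry.
  - by rewrite capF.
  move=> a b ab; apply/subsetPset => y [x Fx xy]; exists x => //.
  by apply: le_ball xy; rewrite lef_pV2 ?posrE// ler_nat.
by rewrite capF; apply: cvge_ge; apply: nearW => n; exact: PQn.
Qed.

(** Closed sets, equivalently open sets, form a generating pi-system. *)
Lemma same_law_of_small_couplings k (P Q : probability 'cV[R]_k R) :
  (forall e : R, 0 < e ->
    exists2 g, couplings P Q g & (transport_cost (@sqnorm2 R k) g <= e%:E)%E) ->
  same_law P Q.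
Proof.
move=> small.
have small' e : 0 < e -> exists2 g, couplings Q P g &
    (transport_cost (@sqnorm2 R k) g <= e%:E)%E.
  move=> /small[g gPQ ge]; exists (law g (@measurable_swap k)).
    by move=> S mS; have [gP gQ] := gPQ S mS; split; [exact: gQ|exact: gP].
  rewrite transport_cost_law; first last.
  - exact: sqnorm2_ge0.
  - exact: measurable_sqnorm2.
  apply: le_trans ge; rewrite le_eqVlt; apply/orP; left; apply/eqP.
  by apply: eq_integral => z _ /=; rewrite -sqnorm2N opprB.
have eq_closed F : closed F -> P F = Q F.
  by move=> cF; apply/eqP; rewrite eq_le !coupling_closed_le.
move=> S mS; apply: (measure_unique (@open 'cV[R]_k) (fun=> setT)) => //.
- by move=> U V; exact: openI.
- by move=> _; exact: openT.
- by rewrite bigcup_const.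
- move=> U oU.
  have mCU : measurable (~` U) by apply: measurableC; exact: open_measurable_mx.
  rewrite -(setCK U) [LHS](probability_setC P mCU) [RHS](probability_setC Q mCU).
  by congr (_ - _)%E; apply: eq_closed; exact: open_closedC.
- by move=> _; rewrite (le_lt_trans (probability_le1 _ _))// ltry.
Qed.

Lemma diagonal_coupling k (P Q : probability 'cV[R]_k R) : same_law P Q ->
  exists2 g, couplings P Q g & transport_cost (@sqnorm2 R k) g = 0%E.
Proof.
move=> PQ.
have md : measurable_fun setT (fun x : 'cV[R]_k => (x, x)).
  exact: measurable_fun_pair.
exists (law P md); first by move=> S mS; split=> //; exact: PQ.
rewrite transport_cost_law; first last.
- exact: sqnorm2_ge0.
- exact: measurable_sqnorm2.
by rewrite integral0_eq// => x _ /=; rewrite subrr /sqnorm2 norm2_0 expr0n.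
Qed.

(** The slack is multiplicative, not additive: a radius 0 must give a coupling
    of cost exactly 0, because the cost will be multiplied by second moments
    that may be infinite. That case is the diagonal coupling of two equal
    laws; for a positive finite radius the infimum suffices, and for an
    infinite radius any coupling will do. *)
Lemma near_optimal_coupling k (P Q : probability 'cV[R]_k R) (eps : \bar R) (K : R) :
  (0 <= eps)%E -> wball (@sqnorm2 R k) eps P Q -> 1 < K ->
  exists2 g, couplings P Q g & (transport_cost (@sqnorm2 R k) g <= K%:E * eps)%E.
Proof.
move=> eps0 W K1.
have lt_coupling (a : \bar R) : (eps < a)%E ->
    exists2 g, couplings P Q g & (transport_cost (@sqnorm2 R k) g <= a)%E.
  move=> epsa; have /ereal_inf_lt[_ [g gPQ <-] ga] := le_lt_trans W epsa.
  by exists g => //; exact: ltW.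
move: eps0; rewrite le_eqVlt => /predU1P[eps0|eps0].
  have PQ : same_law P Q.
    by apply: same_law_of_small_couplings => e e0; apply: lt_coupling;
      rewrite -eps0 lte_fin.
  have [g gPQ g0] := diagonal_coupling PQ.
  by exists g => //; rewrite -eps0 mule0 g0.
have [epsoo|epsfin] := eqVneq eps +oo%E.
  exists (P \x Q)%E; last by rewrite epsoo gt0_muley ?leey// lte_fin (lt_trans ltr01).
  move=> S mS; split.
  - rewrite -setXT; apply: etrans (product_measure1E P Q mS measurableT) _.
    by rewrite [X in (_ * X)%E]probability_setT mule1.
  - rewrite -setTX; apply: etrans (product_measure1E P Q measurableT mS) _.
    by rewrite [X in (X * _)%E]probability_setT mul1e.
apply: lt_coupling.
rewrite -[ltLHS]mul1e lte_pmul2r//.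
by rewrite ge0_fin_numE ?ltW// ltey.
Qed.

End couplings.

(** * Affine images of Wasserstein balls *)

Section linear_systems.
Variable R : realType.

Lemma linear_recurrence n (A : 'M[R]_n) (x v : nat -> 'cV[R]_n) :
  (forall t, x t.+1 = A *m x t + v t) ->
  forall t, x t = A ^+ t *m x 0%N + \sum_(i < t) A ^+ i *m v (t - i.+1)%N.
Proof.
move=> xS; elim=> [|t IH]; first by rewrite big_ord0 addr0 expr0 mul1mx.
rewrite xS [in LHS]IH mulmxDr mulmxA -[A *m A ^+ t]exprS -addrA; congr (_ + _).
rewrite big_ord_recl/= expr0 mul1mx subn1/= addrC mulmx_sumr; congr (_ + _).
by apply: eq_bigr => i _; rewrite mulmxA -[A *m A ^+ i]exprS.
Qed.

Lemma power_blocks_stack n k t (A : 'M[R]_n) (B : 'M[R]_(n, k))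
    (v : nat -> 'cV[R]_k) :
  power_blocks t A B *m stack t v =
  \sum_(i < t) A ^+ i *m (B *m v (t - i.+1)%N).
Proof.
by rewrite mul_mxrow_mxcol; apply: eq_bigr => i _; rewrite mulmxA.
Qed.

Lemma measurable_affine p q (b : 'cV[R]_p) (L : 'M[R]_(p, q)) :
  measurable_fun setT (fun x : 'cV[R]_q => b + L *m x).
Proof.
have mbL : measurable_fun setT (fun x : 'cV[R]_q => (b, L *m x)).
  by apply: measurable_fun_pair => //; exact: measurable_mulmx.
exact: (measurableT_comp (@measurable_add_pair R p) mbL).
Qed.

Lemma product_delta_l k l (b : 'cV[R]_k) (P : probability 'cV[R]_l R)
    (mb : measurable_fun setT (fun x : 'cV[R]_l => (b, x))) :
  same_law (prob_delta b \x P)%E (law P mb).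
Proof.
apply: same_law_product => S1 S2 _ _; rewrite [prob_delta b S1]diracE.
have [bS1|bS1] := boolP (b \in S1).
  rewrite mul1e; congr (P _); apply/seteqP; split => x /=; first by case.
  by move=> ?; split => //; exact/set_mem.
rewrite mul0e -[RHS](measure0 P); congr (P _); apply/seteqP; split => x //= -[].
by move/mem_set; rewrite (negbTE bS1).
Qed.

Lemma product_delta_r k l (b : 'cV[R]_k) (P : probability 'cV[R]_l R)
    (mb : measurable_fun setT (fun x : 'cV[R]_l => (x, b))) :
  same_law (P \x prob_delta b)%E (law P mb).
Proof.
apply: same_law_product => S1 S2 _ _; rewrite [prob_delta b S2]diracE.
have [bS2|bS2] := boolP (b \in S2).
  rewrite mule1; congr (P _); apply/seteqP; split => x /=; first by case.
  by move=> ?; split => //; exact/set_mem.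
rewrite mule0 -[RHS](measure0 P); congr (P _); apply/seteqP; split => x //= -[_].
by move/mem_set; rewrite (negbTE bS2).
Qed.

Lemma conv_delta_push p q (b : 'cV[R]_p) (L : 'M[R]_(p, q))
    (P : probability 'cV[R]_q R) :
  same_law (law P (measurable_affine b L))
    (prob_conv (prob_delta b) (prob_push L P)).
Proof.
move=> S mS.
have mb : measurable_fun setT (fun x : 'cV[R]_p => (b, x)).
  exact: measurable_fun_pair.
exact: (esym (@product_delta_l _ _ b (prob_push L P) mb _
  (measurable_preimage (@measurable_add_pair R p) mS))).
Qed.

(** The translation by [b] cancels in differences, and [L^+ L] contracts. *)
Lemma wball_affine p q (b : 'cV[R]_p) (L : 'M[R]_(p, q)) (eps : \bar R)
    (P Q : probability 'cV[R]_q R) (Q' : probability 'cV[R]_p R) :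
  wball (@sqnorm2 R _) eps P Q ->
  same_law (law Q (measurable_affine b L)) Q' ->
  wball (@sqnorm2 R _ \o mulmx (moore_penrose L)) eps
    (prob_conv (prob_delta b) (prob_push L P)) Q'.
Proof.
move=> PQ QQ'; apply: le_trans PQ.
apply: (wasserstein_law _ _ _ _ _ (conv_delta_push b L P) QQ').
- exact: measurable_sqnorm2.
- exact: (measurableT_comp (@measurable_sqnorm2 _ _) (measurable_mulmx _)).
- exact: sqnorm2_ge0.
- by move=> x; exact: sqnorm2_ge0.
- move=> x y /=; rewrite opprD addrACA subrr add0r -mulmxBr.
  exact: moore_penrose_contraction.
Qed.

End linear_systems.


(** * Joint laws of independent vectors *)

Section independence.
Variable R : realType.

(** Independence of an event extends from rectangles to all measurable sets
    of the product, since rectangles form a generating pi-system. *)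
Lemma independent_of_rectangles d d1 d2 (Omega : measurableType d)
    (T1 : measurableType d1) (T2 : measurableType d2) (Pr : probability Omega R)
    (Z : Omega -> T1 * T2) (E : set Omega) :
  measurable_fun setT Z -> measurable E ->
  (forall S1 S2, measurable S1 -> measurable S2 ->
    Pr (Z @^-1` (S1 `*` S2) `&` E) = (Pr (Z @^-1` (S1 `*` S2)) * Pr E)%E) ->
  forall V, measurable V -> Pr (Z @^-1` V `&` E) = (Pr (Z @^-1` V) * Pr E)%E.
Proof.
move=> mZ mE rect V; rewrite measurable_prod_measurableType.
have mpre W : measurable W -> measurable (Z @^-1` W) := measurable_preimage mZ.
move: V; apply: dynkin_induction => /=.
- by rewrite measurable_prod_measurableType.
- move=> _ _ [A1 mA1 [A2 mA2 <-]] [B1 mB1 [B2 mB2 <-]].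
  exists (A1 `&` B1); first exact: measurableI.
  exists (A2 `&` B2); first exact: measurableI.
  by rewrite setXI.
- by rewrite preimage_setT setTI probability_setT mul1e.
- by move=> _ [A mA [B mB <-]]; exact: rect.
- move=> S mS HS.
  have PE : (Pr E < +oo)%E by rewrite (le_lt_trans (probability_le1 _ _))// ltry.
  transitivity (Pr E - Pr (Z @^-1` S `&` E))%E.
    by rewrite preimage_setC setIC -setDE (setIC _ E); exact: measureD (mpre _ mS) PE.
  rewrite HS preimage_setC probability_setC; last exact: mpre.
  have finE : Pr E \is a fin_num by exact: fin_num_measure.
  by rewrite muleBl ?mul1e// fin_num_adde_defl.
- move=> F mF tF Fn.
  have tZF : trivIset setT (fun k => Z @^-1` F k).
    by move=> i j _ _ [x [Fi Fj]]; apply: tF => //; exists (Z x).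
  have tZFE : trivIset setT (fun k => Z @^-1` F k `&` E) by exact: trivIset_setIr.
  have mZF k : measurable (Z @^-1` F k) by exact: mpre.
  have mZFE k : measurable (Z @^-1` F k `&` E) by exact: measurableI.
  rewrite preimage_bigcup setI_bigcupl.
  transitivity (\sum_(k <oo) Pr (Z @^-1` F k `&` E))%E.
    by apply: measure_semi_bigcup => //; exact: bigcup_measurable.
  transitivity ((\sum_(k <oo) Pr (Z @^-1` F k)) * Pr E)%E; last first.
    congr (_ * _)%E; apply: esym; apply: measure_semi_bigcup => //.
    exact: bigcup_measurable.
  have PE : Pr E = (fine (Pr E))%:E by rewrite fineK//; exact: fin_num_measure.
  rewrite muleC PE -nneseriesZl//.
  by apply: eq_eseriesr => k _; rewrite Fn muleC [in LHS]PE.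
Qed.

(** The order [((Y, X), W)] is that of the arguments in which one step of the
    multiplicative system is written below. *)
Lemma independent3_law d (Omega : measurableType d) (Pr : probability Omega R)
    p q k (X : {RV Pr >-> 'cV[R]_p}) (Y : {RV Pr >-> 'cV[R]_q})
    (W : {RV Pr >-> 'cV[R]_k}) PX PY PW
    (mZ : measurable_fun setT (fun omega => ((Y omega, X omega), W omega))) :
  has_law X PX -> has_law Y PY -> has_law W PW -> independent3 X Y W ->
  same_law ((PY \x PX) \x PW)%E (law Pr mZ).
Proof.
move=> XP YP WP XYW.
have mYX : measurable_fun setT (fun omega => (Y omega, X omega)).
  exact: measurable_fun_pair.
have YX : same_law (PY \x PX)%E (law Pr mYX).
  apply: same_law_product => S1 S2 mS1 mS2.
  rewrite -YP// -XP//.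
  have := XYW S2 S1 setT mS2 mS1 measurableT.
  rewrite preimage_setT setIT probability_setT mule1 muleC => <-.
  by rewrite setIC.
apply: same_law_product => V U mV mU.
rewrite YX// -WP//.
apply: (independent_of_rectangles (Z := fun omega => (Y omega, X omega))) => //.
  exact: measurable_preimage.
move=> S1 S2 mS1 mS2.
have XY : Pr ((fun omega => (Y omega, X omega)) @^-1` (S1 `*` S2)) =
    (Pr (X @^-1` S2) * Pr (Y @^-1` S1))%E.
  have := XYW S2 S1 setT mS2 mS1 measurableT.
  rewrite preimage_setT setIT probability_setT mule1 => <-.
  by rewrite setIC.
rewrite XY -XYW//; congr (Pr (_ `&` _)).
by rewrite setIC.
Qed.

End independence.

(** * The L2 seminorm with extended values *)

Section l2_norm.
Context d (T : measurableType d) (R : realType).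
Implicit Types (mu : probability T R) (f g : T -> R).

(** Same value as [Lnorm mu 2%:E], but expressed with the square root that
    occurs in the radius. *)
Definition l2 mu f : \bar R := sqrte (\int[mu]_x (f x ^+ 2)%:E)%E.

Lemma l2_ge0 mu f : (0 <= l2 mu f)%E.
Proof. exact: sqrte_ge0. Qed.

Lemma l2_sqr mu f : (l2 mu f ^+ 2 = \int[mu]_x (f x ^+ 2)%:E)%E.
Proof. by rewrite sqr_sqrte//; apply: integral_ge0 => x _; rewrite lee_fin sqr_ge0. Qed.

Lemma l2_Lnorm mu f : l2 mu f = Lnorm mu 2%:E (EFin \o f).
Proof.
rewrite unlock /Lnorm poweR12_sqrt; last first.
  by apply: integral_ge0 => x _; exact: poweR_ge0.
congr sqrte; apply: eq_integral => x _ /=.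
by rewrite powR_mulrn// real_normK// num_real.
Qed.

Lemma l2_triangle mu f g : measurable_fun setT f -> measurable_fun setT g ->
  (l2 mu (f \+ g)%R <= l2 mu f + l2 mu g)%E.
Proof.
by move=> mf mg; rewrite !l2_Lnorm; apply: minkowski_EFin => //; rewrite ler1n.
Qed.

Lemma le_l2 mu f g : measurable_fun setT f -> measurable_fun setT g ->
  (forall x, 0 <= f x) -> (forall x, f x <= g x) -> (l2 mu f <= l2 mu g)%E.
Proof.
move=> mf mg f0 fg; rewrite lee_sqrt; last first.
  by apply: integral_ge0 => x _; rewrite lee_fin sqr_ge0.
apply: ge0_le_integral => //.
- by move=> x _; rewrite lee_fin sqr_ge0.
- by apply/measurable_EFinP/measurable_funX.
- by apply/measurable_EFinP/measurable_funX.
- move=> x _; rewrite lee_fin ler_pXn2r// nnegrE//.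
  exact: le_trans (fg x).
Qed.

Lemma l2Z mu (a : R) f : measurable_fun setT f -> 0 <= a ->
  (l2 mu (fun x => a * f x)%R = l2 mu f * a%:E)%E.
Proof.
move=> mf a0; rewrite /l2; under eq_integral do rewrite exprMn EFinM.
rewrite ge0_integralZl//; first last.
- by rewrite lee_fin sqr_ge0.
- by move=> x _; rewrite lee_fin sqr_ge0.
- by apply/measurable_EFinP/measurable_funX.
rewrite sqrteM ?lee_fin ?sqr_ge0// muleC; congr (_ * _)%E.
by rewrite /sqrte sqrtr_sqr ger0_norm.
Qed.

End l2_norm.

Section l2_product.
Context d1 d2 (T1 : measurableType d1) (T2 : measurableType d2) (R : realType).
Variables (P : probability T1 R) (Q : probability T2 R).

Lemma l2_productM (f : T1 -> R) (g : T2 -> R) :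
  measurable_fun setT f -> measurable_fun setT g ->
  (l2 (P \x Q)%E (fun z => f z.1 * g z.2)%R = l2 P f * l2 Q g)%E.
Proof.
move=> mf mg; rewrite /l2 -sqrteM; last first.
  by apply: integral_ge0 => x _; rewrite lee_fin sqr_ge0.
congr sqrte; rewrite -(@ge0_integral_productM _ _ _ _ _ P Q
  (fun x => f x ^+ 2) (fun x => g x ^+ 2)).
- by apply: eq_integral => z _; rewrite exprMn.
- exact: measurable_funX.
- exact: measurable_funX.
- by move=> x; exact: sqr_ge0.
- by move=> x; exact: sqr_ge0.
Qed.

Lemma l2_product1 (f : T1 -> R) : measurable_fun setT f ->
  l2 (P \x Q)%E (fun z => f z.1) = l2 P f.
Proof.
move=> mf; congr sqrte.
apply: (ge0_integral_product1 P Q (c := fun x => f x ^+ 2)).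
- exact: measurable_funX.
- by move=> x; exact: sqr_ge0.
Qed.

Lemma l2_product2 (f : T2 -> R) : measurable_fun setT f ->
  l2 (P \x Q)%E (fun z => f z.2) = l2 Q f.
Proof.
move=> mf; congr sqrte.
apply: (ge0_integral_product2 P Q (c := fun x => f x ^+ 2)).
- exact: measurable_funX.
- by move=> x; exact: sqr_ge0.
Qed.

End l2_product.

(** * One step of the multiplicative system *)

Section marginals.
Variable R : realType.

Lemma product3_law d1 d2 d3 d1' d2' d3'
    (T1 : measurableType d1) (T2 : measurableType d2) (T3 : measurableType d3)
    (T1' : measurableType d1') (T2' : measurableType d2') (T3' : measurableType d3')
    (f1 : T1 -> T1') (f2 : T2 -> T2') (f3 : T3 -> T3')
    (mf1 : measurable_fun setT f1) (mf2 : measurable_fun setT f2)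
    (mf3 : measurable_fun setT f3)
    (mf : measurable_fun setT (fun z : T1 * T2 * T3 => ((f1 z.1.1, f2 z.1.2), f3 z.2)))
    (P1 : probability T1 R) (P2 : probability T2 R) (P3 : probability T3 R)
    (Q1 : probability T1' R) (Q2 : probability T2' R) (Q3 : probability T3' R) :
  same_law (law P1 mf1) Q1 -> same_law (law P2 mf2) Q2 -> same_law (law P3 mf3) Q3 ->
  same_law (law ((P1 \x P2) \x P3)%E mf) ((Q1 \x Q2) \x Q3)%E.
Proof.
move=> PQ1 PQ2 PQ3 S mS.
have mf12 := measurable_map_pair mf1 mf2.
have PQ12 : same_law (law (P1 \x P2)%E mf12) (Q1 \x Q2)%E.
  move=> V mV; rewrite -(law_product P1 P2 mf1 mf2 mf12 mV).
  exact: same_law_prod.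
apply: etrans (esym (law_product (P1 \x P2)%E P3 mf12 mf3 mf mS)) _.
exact: same_law_prod.
Qed.

Lemma l2_marginal1 k (P Q : probability 'cV[R]_k R) g (f : 'cV[R]_k -> R) :
  couplings P Q g -> measurable_fun setT f ->
  l2 g (fun z => f z.1) = l2 P f.
Proof.
move=> gPQ mf; congr sqrte.
rewrite -(ge0_integral_law g (@measurable_fst _ _ _ _) (c := fun x => f x ^+ 2)).
- by apply: eq_law_integral => S mS; have [] := gPQ S mS.
- exact: measurable_funX.
- by move=> x; exact: sqr_ge0.
Qed.

Lemma l2_push p q (L : 'M[R]_(p, q)) (P : probability 'cV[R]_q R) :
  l2 P (fun x => norm2 (L *m x)) = sqrte (second_moment (prob_push L P)).
Proof.
congr sqrte.
rewrite /second_moment -(ge0_integral_law P (measurable_mulmx L) (c := @sqnorm2 R p)).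
- exact: eq_law_integral.
- exact: measurable_sqnorm2.
- exact: sqnorm2_ge0.
Qed.

End marginals.

Section multiplicative_step.
Variables (R : realType) (n : nat) (A : 'M[R]_n) (b : 'cV[R]_n).
Local Notation V := 'cV[R]_n.
Local Notation VV := (V * V)%type.

(** The arguments are the independent triple: first noise, state, second
    noise. *)
Definition mult_step (z : V * V * V) : V :=
  hadamard z.1.1 (A *m z.1.2) + hadamard z.2 b.

Lemma measurable_mult_step : measurable_fun setT mult_step.
Proof.
have mfst : measurable_fun setT (fun z : V * V * V =>
    hadamard z.1.1 (A *m z.1.2)).
  have m1 : measurable_fun setT (fun z : V * V * V => (z.1.1, A *m z.1.2)).
    apply: measurable_fun_pair; first exact: (measurableT_comp measurable_fst).
    apply: (measurableT_comp (@measurable_mulmx _ _ _ A)).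
    exact: (measurableT_comp measurable_snd).
  exact: (measurableT_comp (@measurable_hadamard_pair R n) m1).
have msnd : measurable_fun setT (fun z : V * V * V =>
    hadamard z.2 b).
  have m2 : measurable_fun setT (fun z : V * V * V => (z.2, b)).
    exact: measurable_fun_pair.
  exact: (measurableT_comp (@measurable_hadamard_pair R n) m2).
exact: (measurableT_comp (@measurable_add_pair R n) (measurable_fun_pair mfst msnd)).
Qed.

Lemma mult_step_law (P1 P P2 : probability V R) :
  same_law (law ((P1 \x P) \x P2)%E measurable_mult_step)
    (prob_conv (prob_odot P1 (prob_push A P)) (prob_odot P2 (prob_delta b))).
Proof.
have mA : measurable_fun setT (fun z : VV => (z.1, A *m z.2)).
  exact: (measurable_map_pair (@measurable_id _ _ _) (measurable_mulmx A)).
have m1 : measurable_fun setT (fun z : VV => hadamard z.1 (A *m z.2)).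
  exact: (measurableT_comp (@measurable_hadamard_pair R n) mA).
have mb : measurable_fun setT (fun x : V => (x, b)).
  exact: measurable_fun_pair.
have m2 : measurable_fun setT (fun x : V => hadamard x b).
  exact: (measurableT_comp (@measurable_hadamard_pair R n) mb).
have odot1 : same_law (prob_odot P1 (prob_push A P)) (law (P1 \x P)%E m1).
  move=> S mS.
  exact: (law_product P1 P (@measurable_id _ _ _) (measurable_mulmx A) mA
    (measurable_preimage (@measurable_hadamard_pair R n) mS)).
have odot2 : same_law (prob_odot P2 (prob_delta b)) (law P2 m2).
  move=> S mS.
  exact: (@product_delta_r R n n b P2 mb _
    (measurable_preimage (@measurable_hadamard_pair R n) mS)).
have m12 := measurable_map_pair m1 m2.
move=> S mS; apply: esym.
have mS' := measurable_preimage (@measurable_add_pair R n) mS.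
apply: etrans (law_product (P1 \x P)%E P2 m1 m2 m12 mS').
exact: (same_law_prod odot1 odot2 mS').
Qed.

Let dist (z : VV) := norm2 (z.1 - z.2).

(** [p.Ap' - q.Aq' = - (p - q).A(p' - q') + p.A(p' - q') + (p - q).Ap'] where
    [.] is the entrywise product: only moments of the reference laws, the left
    components, appear besides the transport distances. *)
Lemma norm2_mult_step_diff (z1 z z2 : VV) :
  norm2 (mult_step ((z1.1, z.1), z2.1) - mult_step ((z1.2, z.2), z2.2)) <=
  dist z1 * norm2 (A *m (z.1 - z.2)) + norm2 z1.1 * norm2 (A *m (z.1 - z.2))
  + dist z1 * norm2 (A *m z.1) + norm2 b * dist z2.
Proof.
have -> : mult_step ((z1.1, z.1), z2.1) - mult_step ((z1.2, z.2), z2.2) =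
    - hadamard (z1.1 - z1.2) (A *m (z.1 - z.2)) + hadamard z1.1 (A *m (z.1 - z.2))
    + hadamard (z1.1 - z1.2) (A *m z.1) + hadamard (z2.1 - z2.2) b.
  rewrite /mult_step /= mulmxBr; apply/matrixP => i j; rewrite ord1.
  move: (A *m z.1) (A *m z.2) => y1 y2.
  by rewrite !mxE; ring.
apply: le_trans (norm2D _ _) _; apply: lerD; last first.
  by rewrite mulrC; exact: norm2_hadamard.
apply: le_trans (norm2D _ _) _; apply: lerD; last exact: norm2_hadamard.
apply: le_trans (norm2D _ _) _; apply: lerD; last exact: norm2_hadamard.
by rewrite norm2N; exact: norm2_hadamard.
Qed.

Local Notation C := (transport_cost (@sqnorm2 R n)).

(** Run the step on both components of independent couplings of the three
    inputs. Minkowski's inequality splits the cost along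
    [norm2_mult_step_diff], and independence turns each product into a product
    of L2 seminorms. *)
Lemma mult_step_cost (P1 P P2 Q1 Q Q2 : probability V R) g1 g g2 :
  couplings P1 Q1 g1 -> couplings P Q g -> couplings P2 Q2 g2 ->
  (wasserstein (@sqnorm2 R n)
    (prob_conv (prob_odot P1 (prob_push A P)) (prob_odot P2 (prob_delta b)))
    (prob_conv (prob_odot Q1 (prob_push A Q)) (prob_odot Q2 (prob_delta b)))
  <= (sqrte (C g1) * (sqrte (C g) * (sigma_max A)%:E)
      + sqrte (second_moment P1) * (sqrte (C g) * (sigma_max A)%:E)
      + sqrte (C g1) * sqrte (second_moment (prob_push A P))
      + sqrte (C g2) * (norm2 b)%:E) ^+ 2)%E.
Proof.
move=> gPQ1 gPQ gPQ2.
pose left (z : VV * VV * VV) :=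
  ((z.1.1.1, z.1.2.1), z.2.1).
pose right (z : VV * VV * VV) :=
  ((z.1.1.2, z.1.2.2), z.2.2).
have mfst : measurable_fun setT (@fst V V) by exact: measurable_fst.
have msnd : measurable_fun setT (@snd V V) by exact: measurable_snd.
have mleft : measurable_fun setT left.
  exact: (measurable_map_pair (measurable_map_pair mfst mfst) mfst).
have mright : measurable_fun setT right.
  exact: (measurable_map_pair (measurable_map_pair msnd msnd) msnd).
pose G := ((g1 \x g) \x g2)%E : probability _ R.
have mF : measurable_fun setT (fun z => (mult_step (left z), mult_step (right z))).
  apply: measurable_fun_pair.
  - exact: (measurableT_comp measurable_mult_step mleft).
  - exact: (measurableT_comp measurable_mult_step mright).
have marg1 k (P' Q' : probability 'cV[R]_k R) h :
    couplings P' Q' h -> same_law (law h (@measurable_fst _ _ _ _)) P'.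
  by move=> hPQ S mS; have [] := hPQ S mS.
have marg2 k (P' Q' : probability 'cV[R]_k R) h :
    couplings P' Q' h -> same_law (law h (@measurable_snd _ _ _ _)) Q'.
  by move=> hPQ S mS; have [] := hPQ S mS.
have coupled : couplings
    (prob_conv (prob_odot P1 (prob_push A P)) (prob_odot P2 (prob_delta b)))
    (prob_conv (prob_odot Q1 (prob_push A Q)) (prob_odot Q2 (prob_delta b)))
    (law G mF).
  move=> S mS; have mS' := measurable_preimage measurable_mult_step mS.
  split.
  - apply: etrans (mult_step_law P1 P P2 mS).
    exact: (product3_law mleft (marg1 _ _ _ _ gPQ1) (marg1 _ _ _ _ gPQ)
      (marg1 _ _ _ _ gPQ2) mS').
  - apply: etrans (mult_step_law Q1 Q Q2 mS).
    exact: (product3_law mright (marg2 _ _ _ _ gPQ1) (marg2 _ _ _ _ gPQ)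
      (marg2 _ _ _ _ gPQ2) mS').
apply: le_trans (wasserstein_le _ coupled) _.
rewrite transport_cost_law; first last.
- exact: sqnorm2_ge0.
- exact: measurable_sqnorm2.
rewrite -(l2_sqr G (fun z => norm2 (mult_step (left z) - mult_step (right z)))).
have mnorm := @measurable_norm2 R n.
have mA := @measurable_mulmx R n n A.
have mdist : measurable_fun setT dist.
  exact: (measurableT_comp mnorm (@measurable_diff _ _)).
pose Adist (z : VV) := norm2 (A *m (z.1 - z.2)).
have mAdist : measurable_fun setT Adist.
  exact: (measurableT_comp mnorm (measurableT_comp mA (@measurable_diff _ _))).
pose n1 (z : VV) := norm2 z.1.
have mn1 : measurable_fun setT n1 by exact: (measurableT_comp mnorm mfst).
pose An1 (z : VV) := norm2 (A *m z.1).
have mAn1 : measurable_fun setT An1.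
  exact: (measurableT_comp mnorm (measurableT_comp mA mfst)).
have mM (f h : VV -> R) : measurable_fun setT f -> measurable_fun setT h ->
    measurable_fun setT (fun z : VV * VV => f z.1 * h z.2).
  move=> mf mh; apply: measurable_funM.
  - exact: (measurableT_comp mf measurable_fst).
  - exact: (measurableT_comp mh measurable_snd).
have m1 := mM _ _ mdist mAdist; have m2 := mM _ _ mn1 mAdist.
have m3 := mM _ _ mdist mAn1.
have mfst' (f : VV * VV -> R) :
    measurable_fun setT f -> measurable_fun setT
      (fun z : VV * VV * VV => f z.1).
  by move=> mf; exact: (measurableT_comp mf measurable_fst).
have m4 : measurable_fun setT (fun z : VV => norm2 b * dist z).
  exact: measurable_funM.
have m4' : measurable_fun setT
      (fun z : VV * VV * VV => norm2 b * dist z.2).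
  by exact: (measurableT_comp m4 measurable_snd).
have Adist_le : (l2 g Adist <= sqrte (C g) * (sigma_max A)%:E)%E.
  rewrite -[X in (X * _)%E]/(l2 g dist) -l2Z ?sigma_max_ge0//.
  apply: le_l2 => //; first exact: measurable_funM.
    by move=> z; exact: norm2_ge0.
  by move=> z; exact: sigma_maxP.
rewrite lee_sqr ?l2_ge0//; last first.
  by rewrite !adde_ge0// !mule_ge0 ?sqrte_ge0// lee_fin ?sigma_max_ge0 ?norm2_ge0.
pose f1 (z : VV * VV * VV) := dist z.1.1 * Adist z.1.2.
pose f2 (z : VV * VV * VV) := n1 z.1.1 * Adist z.1.2.
pose f3 (z : VV * VV * VV) := dist z.1.1 * An1 z.1.2.
pose f4 (z : VV * VV * VV) := norm2 b * dist z.2.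
have mf1 : measurable_fun setT f1 := mfst' _ m1.
have mf2 : measurable_fun setT f2 := mfst' _ m2.
have mf3 : measurable_fun setT f3 := mfst' _ m3.
have mf4 : measurable_fun setT f4 := m4'.
have mf12 : measurable_fun setT (f1 \+ f2) by exact: measurable_funD.
have mf123 : measurable_fun setT (f1 \+ f2 \+ f3) by exact: measurable_funD.
apply: (@le_trans _ _ (l2 G (f1 \+ f2 \+ f3 \+ f4))).
  apply: le_l2.
  - exact: (measurableT_comp mnorm (measurableT_comp (@measurable_diff _ _) mF)).
  - exact: measurable_funD.
  - by move=> z; exact: norm2_ge0.
  - by move=> z; exact: norm2_mult_step_diff.
apply: le_trans (l2_triangle G mf123 mf4) _; apply: leeD.
  apply: le_trans (l2_triangle G mf12 mf3) _; apply: leeD.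
    apply: le_trans (l2_triangle G mf1 mf2) _; apply: leeD.
      rewrite (l2_product1 (g1 \x g)%E g2 m1) l2_productM//.
      by apply: lee_pmul; rewrite ?l2_ge0.
    rewrite (l2_product1 (g1 \x g)%E g2 m2) l2_productM// (l2_marginal1 gPQ1)//.
    by apply: lee_pmul; rewrite ?l2_ge0.
  rewrite (l2_product1 (g1 \x g)%E g2 m3) l2_productM//.
  by rewrite (l2_marginal1 (f := fun x => norm2 (A *m x)) gPQ)// ?l2_push//;
    exact: (measurableT_comp mnorm mA).
by rewrite (l2_product2 (g1 \x g)%E g2 m4) l2Z ?norm2_ge0.
Qed.

End multiplicative_step.

(** Each term of the left side is at most [s] or [s ^+ 2] times the
    corresponding term of the radius, according to whether it contains one or
    two approximate transport costs. *)
Lemma radius_scaling (R : realType) (s : R) (e1 e2 rho M1 M2 X1 X X2 : \bar R)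
    (sigma beta : R) :
  1 < s -> 0 <= sigma -> 0 <= beta ->
  (0 <= e1)%E -> (0 <= e2)%E -> (0 <= rho)%E -> (0 <= M1)%E -> (0 <= M2)%E ->
  (0 <= X1)%E -> (0 <= X)%E -> (0 <= X2)%E ->
  (X1 <= s%:E * sqrte e1)%E -> (X <= s%:E * sqrte rho)%E ->
  (X2 <= s%:E * sqrte e2)%E ->
  (X1 * (X * sigma%:E) + sqrte M1 * (X * sigma%:E) + X1 * sqrte M2 + X2 * beta%:E <=
   (s ^+ 2)%:E * (sqrte (e1 * rho) * sigma%:E + sqrte (rho * M1) * sigma%:E
     + sqrte (e1 * M2) + sqrte e2 * beta%:E))%E.
Proof.
move=> s1 sig0 b0 e10 e20 rho0 M10 M20 X10 X0 X20 X1le Xle X2le.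
have s0 : 0 <= s by rewrite ltW// (lt_trans ltr01).
have weaken (e : \bar R) : (0 <= e)%E -> (s%:E * e <= (s ^+ 2)%:E * e)%E.
  by move=> e0; apply: lee_wpmul2r => //; rewrite lee_fin expr2 ler_peMl// ltW.
rewrite !ge0_muleDr ?adde_ge0 ?mule_ge0 ?sqrte_ge0//.
apply: leeD; [apply: leeD; [apply: leeD|]|].
- apply: (@le_trans _ _ ((s%:E * sqrte e1) * (s%:E * sqrte rho * sigma%:E))%E).
    by rewrite lee_pmul ?mule_ge0 ?sqrte_ge0// lee_wpmul2r.
  rewrite -[(s%:E * sqrte rho * _)%E]muleA muleACA -EFinM -expr2.
  by rewrite [(sqrte e1 * (_ * _))%E]muleA -sqrteM.
- apply: le_trans _ (weaken _ _); last by rewrite mule_ge0 ?sqrte_ge0.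
  rewrite [sqrte (rho * _)%E]sqrteM// -[(sqrte rho * _ * _)%E]muleA
    [leLHS]muleCA [leRHS]muleA.
  by rewrite lee_wpmul2r ?mule_ge0 ?sqrte_ge0.
- apply: le_trans _ (weaken _ _); last by rewrite sqrte_ge0.
  by rewrite sqrteM// muleA lee_wpmul2r ?sqrte_ge0.
- apply: le_trans _ (weaken _ _); last by rewrite mule_ge0 ?sqrte_ge0.
  by rewrite muleA lee_wpmul2r.
Qed.

Section multiplicative_step_wasserstein.
Variables (R : realType) (n : nat) (A : 'M[R]_n) (b : 'cV[R]_n).

Lemma wasserstein_ge0 k (P Q : probability 'cV[R]_k R) :
  (0 <= wasserstein (@sqnorm2 R k) P Q)%E.
Proof.
apply: le_ereal_inf_tmp => _ [g _ <-]; apply: transport_cost_ge0.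
exact: sqnorm2_ge0.
Qed.

Lemma second_moment_ge0 k (P : probability 'cV[R]_k R) : (0 <= second_moment P)%E.
Proof. by apply: integral_ge0 => x _; rewrite lee_fin sqnorm2_ge0. Qed.

(** Couplings within a factor [s ^+ 2] of the radii bound the distance by
    [s ^+ 4] times the new radius, for every [s > 1]. *)
Lemma wball_mult_step (P1 P P2 Q1 Q Q2 : probability 'cV[R]_n R) (rho : \bar R)
    (eps1 eps2 : R) :
  0 <= eps1 -> 0 <= eps2 -> (0 <= rho)%E ->
  wball (@sqnorm2 R n) eps1%:E P1 Q1 -> wball (@sqnorm2 R n) rho P Q ->
  wball (@sqnorm2 R n) eps2%:E P2 Q2 ->
  wball (@sqnorm2 R n)
    ((sqrte (eps1%:E * rho) * (sigma_max A)%:E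
     + sqrte (rho * second_moment P1) * (sigma_max A)%:E
     + sqrte (eps1%:E * second_moment (prob_push A P))
     + (Num.sqrt eps2 * norm2 b)%:E) ^+ 2)%E
    (prob_conv (prob_odot P1 (prob_push A P)) (prob_odot P2 (prob_delta b)))
    (prob_conv (prob_odot Q1 (prob_push A Q)) (prob_odot Q2 (prob_delta b))).
Proof.
move=> eps1_ge0 eps2_ge0 rho_ge0 W1 W W2.
set S := (X in (X ^+ 2)%E); rewrite /wball/=.
have sig0 : (0 <= (sigma_max A)%:E)%E by rewrite lee_fin sigma_max_ge0.
have S0 : (0 <= S)%E.
  by rewrite /S !adde_ge0// ?mule_ge0 ?sqrte_ge0// lee_fin mulr_ge0 ?sqrtr_ge0 ?norm2_ge0.
apply/lee_mul01Pr; first exact: wasserstein_ge0.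
move=> r /andP[r0 r1].
(* s ^+ 4 = r^-1 *)
pose s := Num.sqrt (Num.sqrt r^-1).
have s4 : s ^+ 2 * s ^+ 2 = r^-1.
  by rewrite sqr_sqrtr ?sqrtr_ge0// -expr2 sqr_sqrtr// invr_ge0 ltW.
have s0 : 0 <= s by exact: sqrtr_ge0.
have s1 : 1 < s.
  by rewrite -[ltLHS]sqrtr1 -sqrtr1 !ltr_sqrt ?sqrtr_gt0 ?invr_gt0// invf_gt1.
have s21 : 1 < s ^+ 2 by rewrite exprn_egt1.
have [g1 gPQ1 C1] := near_optimal_coupling (eps1_ge0 : (0 <= eps1%:E)%E) W1 s21.
have [g gPQ C] := near_optimal_coupling rho_ge0 W s21.
have [g2 gPQ2 C2] := near_optimal_coupling (eps2_ge0 : (0 <= eps2%:E)%E) W2 s21.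
have cost0 h : (0 <= transport_cost (@sqnorm2 R n) h)%E.
  by apply: transport_cost_ge0; exact: sqnorm2_ge0.
have sqrt_le (c e : \bar R) : (0 <= e)%E -> (c <= (s ^+ 2)%:E * e)%E ->
    (sqrte c <= s%:E * sqrte e)%E.
  move=> e0 ce; apply: (@le_trans _ _ (sqrte ((s ^+ 2)%:E * e))).
    by rewrite lee_sqrt// mule_ge0// lee_fin sqr_ge0.
  by rewrite sqrteM ?lee_fin ?sqr_ge0//= sqrtr_sqr ger0_norm.
have {}C1 := sqrt_le _ _ (eps1_ge0 : (0 <= eps1%:E)%E) C1.
have {}C := sqrt_le _ _ rho_ge0 C.
have {}C2 := sqrt_le _ _ (eps2_ge0 : (0 <= eps2%:E)%E) C2.
have := mult_step_cost A b gPQ1 gPQ gPQ2.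
set T := (X in (_ <= X ^+ 2)%E) => bound.
have le_S : (T <= (s ^+ 2)%:E * S)%E.
  by apply: (@radius_scaling R s eps1%:E eps2%:E rho) => //;
    rewrite ?norm2_ge0 ?second_moment_ge0 ?sqrte_ge0.
have T0 : (0 <= T)%E.
  by rewrite /T !adde_ge0// !mule_ge0 ?sqrte_ge0// lee_fin norm2_ge0.
apply: le_trans (lee_wpmul2l _ bound) _; first by rewrite lee_fin ltW.
have sS0 : (0 <= (s ^+ 2)%:E * S)%E by rewrite mule_ge0// lee_fin sqr_ge0.
rewrite -(lee_sqr T0 sS0) in le_S.
apply: le_trans (lee_wpmul2l _ le_S) _; first by rewrite lee_fin ltW.
rewrite expe2 muleACA -EFinM s4 muleA -EFinM mulfV ?gt_eqF// mul1e.
exact: lexx.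
Qed.

End multiplicative_step_wasserstein.

(** * Trajectories of the multiplicative system *)

Lemma eq_wasserstein_r (R : realType) k (c : 'cV[R]_k -> R)
    (P Q Q' : probability 'cV[R]_k R) :
  same_law Q Q' -> wasserstein c P Q = wasserstein c P Q'.
Proof.
move=> QQ'; rewrite /wasserstein (_ : couplings P Q = couplings P Q')//.
by apply/seteqP; split=> g; apply: couplings_same_law => // S mS; rewrite QQ'.
Qed.

Lemma wball_mult_center (R : realType) (n m : nat) (A : 'M[R]_n) (B : 'M[R]_(n, m))
    (u : nat -> 'cV[R]_m) (eps1 eps2 : R) d (Omega : measurableType d)
    (Pr : probability Omega R) (x0 : 'cV[R]_n)
    (x w1 w2 : nat -> {RV Pr >-> 'cV[R]_n}) (P1 P2 Q1 Q2 : probability 'cV[R]_n R) :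
  0 <= eps1 -> 0 <= eps2 ->
  (forall omega, x 0%N omega = x0) ->
  (forall t omega, x t.+1 omega =
     hadamard (w1 t omega) (A *m x t omega) + hadamard (w2 t omega) (B *m u t)) ->
  (forall t, independent3 (x t) (w1 t) (w2 t)) ->
  (forall t, has_law (w1 t) Q1) -> (forall t, has_law (w2 t) Q2) ->
  wball (@sqnorm2 R _) eps1%:E P1 Q1 -> wball (@sqnorm2 R _) eps2%:E P2 Q2 ->
  forall t, wball (@sqnorm2 R _) (mult_radius A B u x0 eps1 eps2 P1 P2 t)
    (mult_center A B u x0 P1 P2 t) (distribution Pr (x t)).
Proof.
move=> eps1_ge0 eps2_ge0 x0E xS indep w1Q1 w2Q2 W1 W2.
have radius_ge0 t : (0 <= mult_radius A B u x0 eps1 eps2 P1 P2 t)%E.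
  case: t => [//|t]; rewrite expe_ge0// !adde_ge0// ?mule_ge0 ?sqrte_ge0//.
  - by rewrite lee_fin sigma_max_ge0.
  - by rewrite lee_fin sigma_max_ge0.
  - by rewrite lee_fin mulr_ge0 ?sqrtr_ge0 ?norm2_ge0.
elim=> [|t IH].
  have /diagonal_coupling[g gPQ g0] :
      same_law (prob_delta x0) (distribution Pr (x 0%N)).
    move=> S mS; rewrite [LHS]diracE.
    have [x0S|x0S] := boolP (x0 \in S).
      rewrite -[LHS](probability_setT Pr); congr (Pr _); apply/seteqP.
      by split=> omega //= _; rewrite x0E; exact/set_mem.
    rewrite -[LHS](measure0 Pr); congr (Pr _); apply/seteqP; split=> omega //=.
    by rewrite x0E => /mem_set; rewrite (negbTE x0S).
  by apply: le_trans (wasserstein_le _ gPQ) _; rewrite g0.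
have step := wball_mult_step A (B *m u t) eps1_ge0 eps2_ge0 (radius_ge0 t) W1 IH W2.
apply: le_trans step; rewrite le_eqVlt; apply/orP; left; apply/eqP.
apply: eq_wasserstein_r => S mS.
have mZ : measurable_fun setT (fun omega => ((w1 t omega, x t omega), w2 t omega)).
  by apply: measurable_fun_pair => //; exact: measurable_fun_pair.
have joint := independent3_law mZ (fun S _ => erefl) (w1Q1 t) (w2Q2 t) (indep t).
apply: etrans (mult_step_law A (B *m u t) Q1 (distribution Pr (x t)) Q2 mS).
have mS' := measurable_preimage (measurable_mult_step A (B *m u t)) mS.
apply: etrans _ (esym (joint _ mS')).
by congr (Pr _); apply/seteqP; split=> omega /=; rewrite xS.
Qed.

Theorem proposition18 (R : realType) (n m r : nat)
    (A : 'M[R]_n) (B : 'M[R]_(n, m)) (D : 'M[R]_(n, r))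
    (u : nat -> 'cV[R]_m) (eps eps1 eps2 : R)
    (eps_ge0 : 0 <= eps) (eps1_ge0 : 0 <= eps1) (eps2_ge0 : 0 <= eps2) :
  (forall (d : measure_display) (Omega : measurableType d)
      (Pr : probability Omega R) (x : nat -> {RV Pr >-> 'cV[R]_n})
      (P0 Q0 : probability 'cV[R]_n R),
    (forall t omega, x t.+1 omega = A *m x t omega + B *m u t) ->
    has_law (x 0%N) Q0 ->
    wball (@sqnorm2 R _) eps%:E P0 Q0 ->
    forall (t : nat) (Qt : probability 'cV[R]_n R), (1 <= t)%N ->
      has_law (x t) Qt ->
      wball (@sqnorm2 R _ \o mulmx (moore_penrose (A ^+ t))) eps%:E
        (prob_conv (prob_delta (power_blocks t A B *m stack t u)) (prob_push (A ^+ t) P0))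
        Qt)
  /\
  (forall (d : measure_display) (Omega : measurableType d)
      (Pr : probability Omega R) (x0 : 'cV[R]_n)
      (x : nat -> {RV Pr >-> 'cV[R]_n}) (w : nat -> {RV Pr >-> 'cV[R]_r}),
    (forall omega, x 0%N omega = x0) ->
    (forall t omega,
       x t.+1 omega = A *m x t omega + B *m u t + D *m w t omega) ->
    forall (t : nat) (Pt : probability 'cV[R]_(\sum_(i < t) r) R)
        (Qt : probability 'cV[R]_n R), (1 <= t)%N ->
      wball (@sqnorm2 R _) eps%:E Pt
        (distribution Pr (stack_rv t w)) ->
      has_law (x t) Qt ->
      wball (@sqnorm2 R _
               \o mulmx (moore_penrose (power_blocks t A D))) eps%:E
        (prob_conv (prob_delta (A ^+ t *m x0 + power_blocks t A B *m stack t u))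
              (prob_push (power_blocks t A D) Pt))
        Qt)
  /\
  (forall (d : measure_display) (Omega : measurableType d)
      (Pr : probability Omega R) (x0 : 'cV[R]_n)
      (x w1 w2 : nat -> {RV Pr >-> 'cV[R]_n})
      (P1 P2 Q1 Q2 : probability 'cV[R]_n R),
    (forall omega, x 0%N omega = x0) ->
    (forall t omega, x t.+1 omega =
       hadamard (w1 t omega) (A *m x t omega)
       + hadamard (w2 t omega) (B *m u t)) ->
    (forall t, independent3 (x t) (w1 t) (w2 t)) ->
    (forall t, has_law (w1 t) Q1) ->
    (forall t, has_law (w2 t) Q2) ->
    wball (@sqnorm2 R _) eps1%:E P1 Q1 ->
    wball (@sqnorm2 R _) eps2%:E P2 Q2 ->
    forall (t : nat) (Qt : probability 'cV[R]_n R),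
      has_law (x t) Qt ->
      wball (@sqnorm2 R _)
        (mult_radius A B u x0 eps1 eps2 P1 P2 t)
        (mult_center A B u x0 P1 P2 t) Qt).
Proof.
split=> [d Omega Pr x P0 Q0 xS x0Q0 PQ t Qt _ xtQt|].
  apply: (wball_affine PQ) => S mS; rewrite -xtQt//.
  have xE omega :
      x t omega = power_blocks t A B *m stack t u + A ^+ t *m x 0%N omega.
    by rewrite (linear_recurrence (fun s => xS s omega)) power_blocks_stack addrC.
  apply: etrans (esym (x0Q0 _ (measurable_preimage (measurable_affine _ _) mS))) _.
  by congr (Pr _); apply/seteqP; split => omega /=; rewrite xE.
split=> [d Omega Pr x0 x w x0E xS t Pt Qt _ PQ xtQt|].
  apply: (wball_affine PQ) => S mS; rewrite -xtQt//.
  have xE omega : x t omega = A ^+ t *m x0 + power_blocks t A B *m stack t u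
      + power_blocks t A D *m stack_rv t w omega.
    have xS' s : x s.+1 omega = A *m x s omega + (B *m u s + D *m w s omega).
      by rewrite xS addrA.
    rewrite (linear_recurrence xS') x0E !power_blocks_stack -addrA -big_split/=.
    by congr (_ + _); apply: eq_bigr => i _; rewrite mulmxDr.
  by congr (Pr _); apply/seteqP; split => omega /=; rewrite xE.
move=> d Omega Pr x0 x w1 w2 P1 P2 Q1 Q2 x0E xS indep w1Q1 w2Q2 W1 W2 t Qt xtQt.
have := wball_mult_center eps1_ge0 eps2_ge0 x0E xS indep w1Q1 w2Q2 W1 W2 t.
by rewrite /wball/= (eq_wasserstein_r _ _ xtQt).
Qed.
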